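(* Let $f:\Omega\to\mathbb{H}^n$ be a continuous map defined on an open set $\Omega\subset\mathbb{R}^m$, and let $\frac12<\gamma\le1$. Then $f\in C^{0,\gamma}_{\rm loc}(\Omega;\mathbb{H}^n)$ if and only if both of the following conditions are satisfied: (a) $\pi\circ f\in C^{0,\gamma}_{\rm loc}(\Omega;\mathbb{R}^{2n})$; (b) $f_\varepsilon^*\alpha\to0$ uniformly as $\varepsilon\to0^+$ on compact subsets of $\Omega$, where $f_\varepsilon=f*\eta_\varepsilon$ is the standard $\varepsilon$-mollification of $f$ (as a map into $\mathbb{R}^{2n+1}$).
   Context: Heisenberg group: $\mathbb{H}^n$ is $\mathbb{R}^{2n+1}$ with coordinates $(z,t)=(x_1,y_1,\dots,x_n,y_n,t)$, regarded as a metric space with the Korányi metric $$d_K\big((z,t),(z',t')\big)=\Big(|z-z'|^4+\Big|t-t'+2\sum_{j=1}^n(x_j'y_j-x_jy_j')\Big|^2\Big)^{1/4}$$ (it induces the Euclidean topology). $\pi:\mathbb{R}^{2n+1}\to\mathbb{R}^{2n}$, $\pi(z,t)=z$. The standard contact form is $\alpha=dt+2\sum_{j=1}^n(x_j\,dy_j-y_j\,dx_j)$. For a metric space $Y$, $C^{0,\gamma}_{\rm loc}(\Omega;Y)$ is the set of maps $f:\Omega\to Y$ that are $\gamma$-Hölder continuous on every compact subset of $\Omega$. Mollification: fix $\eta\in C_c^\infty(\mathbb{B}^m)$ ($\mathbb{B}^m$ the unit ball), $\eta\ge0$, $\int\eta=1$, $\eta_\varepsilon(x)=\varepsilon^{-m}\eta(x/\varepsilon)$;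 $f_\varepsilon=f*\eta_\varepsilon$ componentwise, defined on points at distance $>\varepsilon$ from $\partial\Omega$ (so on any given compact subset of $\Omega$ for all small $\varepsilon$). *)

(* Defs.v *)
From HB Require Import structures.
From mathcomp Require Import all_boot all_order all_algebra.
From mathcomp Require Import all_classical all_reals all_analysis.

Set Implicit Arguments.
Unset Strict Implicit.
Unset Printing Implicit Defensive.

Import Order.TTheory GRing.Theory Num.Theory.
Import numFieldNormedType.Exports.

Local Open Scope classical_set_scope.
Local Open Scope ring_scope.

(* The library norm on 'rV[R]_k is the sup norm; it induces the same topology
   as [eucl_norm], so [open], [compact] and [continuous] need no adaptation. *)
Definition eucl_norm (R : realType) (k : nat) (v : 'rV[R]_k) : R :=
  Num.sqrt (\sum_i v 0 i ^+ 2).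

Definition eucl_dist (R : realType) (k : nat) (u v : 'rV[R]_k) : R :=
  eucl_norm (u - v).

(* Lebesgue measure on m.-tuple R (with the product sigma-algebra of the
   library) is built by recursion as a product measure, transported along
   (x, t) |-> x :: t. *)
Section lebesgue_tuple.
Variable R : realType.
Local Notation RB := (measurableTypeR R).

Definition tcons (n : nat) (p : RB * n.-tuple RB) : n.+1.-tuple RB :=
  [tuple of p.1 :: p.2].

Lemma measurable_tcons (n : nat) : measurable_fun setT (@tcons n).
Proof.
by apply: measurable_cons; [exact: measurable_fst|exact: measurable_snd].
Qed.

Section step.
Variables (n : nat) (mu : {sigma_finite_measure set (n.-tuple RB) -> \bar R}).

Definition lebesgue_cons : set (n.+1.-tuple RB) -> \bar R :=
  pushforward (@lebesgue_measure R \x mu)%E (@tcons n).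

Let cons0 : lebesgue_cons set0 = 0%E.
Proof. by rewrite /lebesgue_cons /pushforward preimage_set0 measure0. Qed.

Let cons_ge0 A : (0 <= lebesgue_cons A)%E.
Proof. by rewrite /lebesgue_cons /pushforward; exact: measure_ge0. Qed.

Let measurable_pre A : measurable A -> measurable (@tcons n @^-1` A).
Proof.
by move=> mA; rewrite -[X in measurable X]setTI; exact: measurable_tcons.
Qed.

Let cons_sigma_additive : semi_sigma_additive lebesgue_cons.
Proof.
move=> F mF tF mUF; rewrite /lebesgue_cons /pushforward preimage_bigcup.
apply: measure_semi_sigma_additive.
- by move=> i; exact: measurable_pre.
- apply/trivIsetP => /= i j _ _ ij; rewrite -preimage_setI.
  by move/trivIsetP : tF => /(_ _ _ _ _ ij) ->//; rewrite preimage_set0.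
- by rewrite -preimage_bigcup; exact: measurable_pre.
Qed.

HB.instance Definition _ := isMeasure.Build _ _ _ lebesgue_cons
  cons0 cons_ge0 cons_sigma_additive.

Let cons_sigma_finite : sigma_finite setT lebesgue_cons.
Proof.
pose g (t : n.+1.-tuple RB) : RB * n.-tuple RB :=
  (tnth t ord0, [tuple of behead t]).
have gK p : g (@tcons n p) = p.
  by case: p => x t; congr (_, _); apply/val_inj.
have mg : measurable_fun setT g.
  apply: measurable_fun_pair; first exact: measurable_tnth.
  exact: measurable_behead.
have /sigma_finiteP[F [TF ndF Foo]] := sigma_finiteT (@lebesgue_measure R).
have /sigma_finiteP[G [TG ndG Goo]] := sigma_finiteT mu.
exists (fun i => g @^-1` (F i `*` G i)).
  apply/seteqP; split => // t _.
  have [i _ Fi] : (\bigcup_i F i) (g t).1 by rewrite -TF.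
  have [j _ Gj] : (\bigcup_i G i) (g t).2 by rewrite -TG.
  exists (maxn i j) => //; split.
  - by move: Fi; exact/subsetPset/ndF/leq_maxl.
  - by move: Gj; exact/subsetPset/ndG/leq_maxr.
move=> i; have [mFi Fi] := Foo i; have [mGi Gi] := Goo i; split.
  by rewrite -[X in measurable X]setTI; apply: mg => //; exact: measurableX.
rewrite /lebesgue_cons /pushforward -comp_preimage.
rewrite (_ : g \o _ = id); last by apply/funext => p; exact: gK.
by rewrite preimage_id product_measure1E// lte_mul_pinfty// ge0_fin_numE.
Qed.

HB.instance Definition _ := Measure_isSigmaFinite.Build _ _ _ lebesgue_cons
  cons_sigma_finite.

End step.

Fixpoint lebesgue_tuple (m : nat) :
    {sigma_finite_measure set (m.-tuple RB) -> \bar R} :=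
  if m is n.+1 then lebesgue_cons (lebesgue_tuple n) else \d_[tuple].

Lemma lebesgue_tuple_box (m : nat) (A : 'I_m -> set RB) :
  (forall i, measurable (A i)) ->
  lebesgue_tuple m [set t | forall i, A i (tnth t i)] =
  (\prod_(i < m) lebesgue_measure (A i))%E.
Proof.
elim: m A => [|m IH] A mA.
  rewrite big_ord0 /= diracE (_ : _ \in _) //; apply/mem_set => -[] //.
rewrite big_ord_recl /= /lebesgue_cons /pushforward.
rewrite (_ : _ @^-1` _ = A ord0 `*`
    [set t : m.-tuple RB | forall i, A (lift ord0 i) (tnth t i)]).
  rewrite product_measure1E//; first by rewrite (IH (fun i => A (lift ord0 i))).
  rewrite (_ : mkset _ = \bigcap_(i in [set: 'I_m])
      ((@tnth m RB)^~ i @^-1` A (lift ord0 i))).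
    apply: fin_bigcap_measurable => // i _.
    by rewrite -[X in measurable X]setTI; exact: measurable_tnth.
  by apply/seteqP; split => [t + i _|t + i]; apply.
apply/seteqP; split => [[x t] /= h|[x t] [/= h0 h] i].
  split => /=; first by have := h ord0.
  by move=> i; have := h (lift ord0 i); rewrite tnthS.
by case: (unliftP ord0 i) => [j|] ->; rewrite ?tnthS.
Qed.

(* \int_D F(y) dy over D in R^m, the tuple t standing for the row vector with
   the same coordinates. *)
Definition integral_rV (m : nat) (D : set 'rV[R]_m) (F : 'rV[R]_m -> R) : R :=
  let row (t : m.-tuple RB) : 'rV[R]_m := \row_i tnth t i in
  \int[lebesgue_tuple m]_(t in row @^-1` D) F (row t).

End lebesgue_tuple.

Section mollification.
Variables (R : realType) (m : nat).

Definition iter_partial (s : seq 'I_m) (F : 'rV[R]_m -> R) : 'rV[R]_m -> R :=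
  foldr (fun i G x => 'D_(delta_mx 0 i) G x) F s.

Definition smooth (F : 'rV[R]_m -> R) : Prop :=
  forall s : seq 'I_m, continuous (iter_partial s F) /\
    forall i x, derivable (iter_partial s F) x (delta_mx 0 i).

Definition Cc_infty_unit_ball (F : 'rV[R]_m -> R) : Prop :=
  [/\ smooth F,
      compact (closure [set x | F x != 0]) &
      closure [set x | F x != 0] `<=` [set x | eucl_norm x < 1]].

Definition mollifier (eta : 'rV[R]_m -> R) : Prop :=
  [/\ Cc_infty_unit_ball eta,
      forall x, 0 <= eta x &
      integral_rV setT eta = 1].

Definition dilate (eta : 'rV[R]_m -> R) (eps : R) (x : 'rV[R]_m) : R :=
  eps ^- m * eta (eps^-1 *: x).

(* Only the values of f on Omega enter; the result is meaningful at points at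
   distance > eps from the complement of Omega. *)
Definition mollify (k : nat) (eta : 'rV[R]_m -> R) (Omega : set 'rV[R]_m)
    (f : 'rV[R]_m -> 'rV[R]_k) (eps : R) (x : 'rV[R]_m) : 'rV[R]_k :=
  \row_i integral_rV Omega (fun y => f y 0 i * dilate eta eps (x - y)).

End mollification.

Definition holder_loc (R : realType) (m : nat) (Y : Type) (d : Y -> Y -> R)
    (gamma : R) (Omega : set 'rV[R]_m) (f : 'rV[R]_m -> Y) : Prop :=
  forall K : set 'rV[R]_m, compact K -> K `<=` Omega ->
    exists C : R, forall x y, K x -> K y ->
      d (f x) (f y) <= C * eucl_dist x y `^ gamma.

(* A 1-form on R^k is a function of a point and a tangent vector. *)
Definition one_form (R : realType) (k : nat) := 'rV[R]_k -> 'rV[R]_k -> R.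

Definition pullback (R : realType) (m k : nat) (g : 'rV[R]_m -> 'rV[R]_k)
    (omega : one_form R k) : one_form R m :=
  fun x v => omega (g x) ('d g x v).

(* The coefficients (a_1, .., a_m) of a_1 dx_1 + .. + a_m dx_m at x. *)
Definition form_coef (R : realType) (m : nat) (omega : one_form R m)
    (x : 'rV[R]_m) : 'rV[R]_m :=
  \row_i omega x (delta_mx 0 i).

(* H^n is R^(2n+1) with coordinates ordered as (x_1, y_1, .., x_n, y_n, t);
   indices start at 0. *)
Section heisenberg.
Variables (R : realType) (n : nat).
Local Notation H := 'rV[R]_(n.*2.+1).

Definition xc (p : H) (j : 'I_n) : R := p 0 (inord j.*2).
Definition yc (p : H) (j : 'I_n) : R := p 0 (inord j.*2.+1).
Definition tc (p : H) : R := p 0 ord_max.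

Definition hproj (p : H) : 'rV[R]_n.*2 :=
  \row_i p 0 (widen_ord (leqnSn n.*2) i).

Definition koranyi (p q : H) : R :=
  (eucl_norm (hproj p - hproj q) ^+ 4 +
   `|tc p - tc q + 2 * \sum_j (xc q j * yc p j - xc p j * yc q j)| ^+ 2)
    `^ 4^-1.

Definition contact_form : one_form R n.*2.+1 :=
  fun p v => tc v + 2 * \sum_j (xc p j * yc v j - yc p j * xc v j).

End heisenberg.

(* Main.v *)
(* Write f = (z, t), let alpha be the contact form, and put
   phi(a, b) = alpha_(f a) (f b - f a), so that
   d_K(f b, f a)^4 = |z(b) - z(a)|^4 + phi(a, b)^2.  Thus f is gamma-Hoelder
   into H^n iff z is gamma-Hoelder and phi(a, b) = O(|a - b|^(2 gamma)).

   If f is Hoelder, differentiate the mollifier under the integral and use that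
   the integral of d_j eta vanishes: the j-th coefficient of f_eps^* alpha at x is
   eps^-1 \int phi(x, x - eps w) d_j eta(w) dw, up to an error bounded by
   |z_eps - z| |d_j z_eps|; both are O(eps^(2 gamma - 1)).

   Conversely, let phi_eps be the analogue of phi for f_eps along a segment
   [a, b].  Its defect of additivity is
   phi_eps(s, t) - phi_eps(s, u) - phi_eps(u, t)
     = 2 omega(z_eps(s) - z_eps(u), z_eps(t) - z_eps(u)),
   which is O(|a - b|^(2 gamma) |t - s|^(2 gamma)) uniformly in eps.  As
   2 gamma > 1, dyadic subdivision bounds |phi_eps(0, 1)| by
   O(|a - b|^(2 gamma)) plus the limit of the sums of phi_eps over the finest
   intervals, which the mean value theorem bounds by
   |b - a| sup |f_eps^* alpha|.  Let eps tend to 0. *)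
Require Import Defs.
From mathcomp Require Import all_boot all_order all_algebra.
From mathcomp Require Import all_classical all_reals all_analysis.
From mathcomp Require Import measurable_realfun ring lra.
Import Order.TTheory GRing.Theory Num.Theory.
Import numFieldNormedType.Exports.
Local Open Scope classical_set_scope.
Local Open Scope ring_scope.

Set Implicit Arguments.
Unset Strict Implicit.
Unset Printing Implicit Defensive.

(** * Lebesgue measure and integration on row vectors *)

Section lebesgue_rV.
Context {R : realType}.
Local Notation RB := (measurableTypeR R).

(** A name for the local [row] of [integral_rV], with the same body, so that facts about it transfer
    to that integral by conversion. *)
Definition row_of_tuple (m : nat) (t : m.-tuple RB) : 'rV[R]_m :=
  \row_i tnth t i.

Lemma normr_rV_leP (m : nat) (v : 'rV[R]_m) (r : R) : 0 <= r ->
  `|v| <= r <-> forall i, `|v 0 i| <= r.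
Proof.
move=> r0; rewrite [`|v|]mx_normrE; split=> [/bigmax_leP[_ h] i|h].
  exact: (h (0, i)).
by apply/bigmax_leP; split=> // -[j i] _ /=; rewrite (ord1 j).
Qed.

Lemma normr_rV_ge (m : nat) (v : 'rV[R]_m) i : `|v 0 i| <= `|v|.
Proof. exact: (normr_rV_leP v (normr_ge0 v)).1. Qed.

Lemma measurable_tuple_box (m : nat) (A : 'I_m -> set RB) :
  (forall i, measurable (A i)) ->
  measurable [set t : m.-tuple RB | forall i, A i (tnth t i)].
Proof.
move=> mA; rewrite (_ : mkset _ = \bigcap_(i in [set: 'I_m])
    ((@tnth m RB)^~ i @^-1` A i)).
  apply: fin_bigcap_measurable => // i _.
  by rewrite -[X in measurable X]setTI; exact: measurable_tnth.
by apply/seteqP; split => [t + i _|t + i]; apply.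
Qed.

(* An open set of R^m is a countable union of boxes with rational centres. *)
Lemma measurable_row_of_tuple_open (m : nat) (U : set 'rV[R]_m) :
  open U -> measurable (@row_of_tuple m @^-1` U).
Proof.
move=> oU.
pose J (qk : 'rV[rat]_m * nat) i : set RB :=
  [set` `]ratr (qk.1 0 i) - qk.2.+1%:R^-1, ratr (qk.1 0 i) + qk.2.+1%:R^-1[].
pose box qk := [set t : m.-tuple RB | forall i, J qk i (tnth t i)].
(* Boxes that leave the preimage of [U] are replaced by the empty set, so the union runs over a
   whole countable type. *)
pose B qk := if pselect (box qk `<=` @row_of_tuple m @^-1` U)
             then box qk else set0.
suff -> : @row_of_tuple m @^-1` U = \bigcup_qk B qk.
  apply: (countable_bigcupT_measurable (U := 'rV[rat]_m * nat)%type) => //.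
  move=> qk; rewrite /B; case: pselect => //= _.
  by apply: (@measurable_tuple_box m (J qk)) => i; exact: measurable_itv.
apply/seteqP; split=> [t Ut|t [qk _]]; last first.
  by rewrite /B; case: pselect => //= h bt; exact: h.
have /nbhs_ballP[e /= e0 He] : nbhs (row_of_tuple t) U.
  exact: open_nbhs_nbhs.
have [k ke] : exists k : nat, k.+1%:R^-1 < e / 2.
  have e20 : 0 < e / 2 by rewrite divr_gt0.
  have [k _ hk] := near_infty_natSinv_lt (PosNum e20).
  by exists k; apply: (hk k) => /=.
have k0 : 0 < k.+1%:R^-1 :> R by rewrite invr_gt0.
pose d : R := k.+1%:R^-1.
have Hq (x : R) : exists q : rat, `|x - ratr q| < d.
  have ltx : x - d < x + d by rewrite ltrBlDr -addrA ltrDl addr_gt0.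
  have [q] := rat_in_itvoo ltx; rewrite in_itv/= => hq.
  by exists q; rewrite distrC ltr_distl.
have [q {}Hq] := choice Hq.
pose qk := (\row_i q (tnth t i), k).
have JE i (x : R) : J qk i x <-> `|x - ratr (q (tnth t i))| < d.
  by rewrite /J/= mxE in_itv/= ltr_distl.
exists qk => //; rewrite /B; case: pselect => /= [h i|].
  by apply/JE; exact: Hq.
case=> s bs /=; apply: He; split => // j i; rewrite !mxE.
have := Hq (tnth t i); have /JE := bs i; rewrite /ball/=.
move: (tnth t i) (tnth s i) => x y /= xq yq.
rewrite (le_lt_trans (ler_distD (ratr (q x)) _ _))// [e]splitr.
by rewrite ltrD// ?[`|ratr _ - _|]distrC (lt_trans _ ke).
Qed.

Lemma measurable_row_of_tuple_comp (m : nat) (F : 'rV[R]_m -> R) :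
  continuous F -> measurable_fun setT (fun t => F (row_of_tuple t) : RB).
Proof.
move=> cF; apply: (measurability (@RGenOpens.G R)).
  exact: RGenOpens.measurableE.
move=> _ [_ [a [b ->] <-]]; rewrite setTI.
apply: (@measurable_row_of_tuple_open m (F @^-1` `]a, b[)).
by apply: open_comp => // x _; exact: cF.
Qed.

(** The right-hand side is a measure in [A]; by uniqueness of Lebesgue measure it is enough to
    compare the two on half-open intervals. *)
Lemma lebesgue_measure_affine (c e : R) (A : set RB) : 0 < e -> measurable A ->
  lebesgue_measure A =
  (e%:E * lebesgue_measure ((fun x : R => (c - e * x)%R : RB) @^-1` A))%E.
Proof.
move=> e0 mA; pose phi (x : RB) : RB := c - e * x.
have mphi : measurable_fun setT phi.
  by apply: continuous_measurable_fun => x; apply: cvgB;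
    [exact: cvg_cst|apply: cvgM; [exact: cvg_cst|exact: cvg_id]].
pose nu := mscale (NngNum (ltW e0)) (pushforward lebesgue_measure phi).
apply: (@lebesgue_measure_unique R (nu mphi)) => // _ [[a b]] _ <-.
rewrite /nu/= /mscale/= /pushforward.
(* [phi] is decreasing, so an interval open on the left and closed on the right pulls back to one
   closed on the left and open on the right. *)
rewrite (_ : phi @^-1` _ = `[(c - b) / e, (c - a) / e[%classic); last first.
  apply/seteqP; split=> x /=; rewrite /phi !in_itv/=.
  - move=> /andP[h1 h2]; rewrite ler_pdivrMr// ltr_pdivlMr//.
    by apply/andP; split; lra.
  - rewrite ler_pdivrMr// ltr_pdivlMr// => /andP[h1 h2].
    by apply/andP; split; lra.
rewrite !lebesgue_measure_itv/= !lte_fin ltr_pM2r ?invr_gt0// ltrD2l ltrN2.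
case: ifPn => // ab; last by rewrite mule0.
rewrite -!EFinB -EFinM; congr EFin; field; lra.
Qed.

Local Open Scope ereal_scope.

Lemma ge0_integral_affine (c e : R) (g : RB -> \bar R) : (0 < e)%R ->
  measurable_fun setT g -> (forall x, 0 <= g x) ->
  \int[lebesgue_measure]_x g x =
  e%:E * \int[lebesgue_measure]_x g (c - e * x)%R.
Proof.
move=> e0 mg g0; pose phi (x : RB) : RB := (c - e * x)%R.
have mphi : measurable_fun setT phi.
  by apply: continuous_measurable_fun => x; apply: cvgB;
    [exact: cvg_cst|apply: cvgM; [exact: cvg_cst|exact: cvg_id]].
pose nu := mscale (NngNum (ltW e0)) (pushforward lebesgue_measure phi).
rewrite (@eq_measure_integral _ _ _ _ (nu mphi)); last first.
  by move=> A mA _; exact: lebesgue_measure_affine.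
rewrite ge0_integral_mscale//=; congr (_ * _).
by rewrite ge0_integral_pushforward//= preimage_setT.
Qed.

Definition affine_tuple (m : nat) (x : 'rV[R]_m) (e : R) (t : m.-tuple RB) :
  m.-tuple RB := [tuple (x 0 i - e * tnth t i)%R | i < m].

Lemma measurable_affine_tuple (m : nat) (x : 'rV[R]_m) (e : R) :
  measurable_fun setT (affine_tuple x e).
Proof.
apply/measurable_fun_tnthP => i /=.
rewrite (_ : _ \o _ = (fun y : RB => x 0 i - e * y : RB)%R \o (@tnth m RB ^~ i)).
  apply: measurableT_comp; last exact: measurable_tnth.
  by apply: continuous_measurable_fun => y; apply: cvgB;
    [exact: cvg_cst|apply: cvgM; [exact: cvg_cst|exact: cvg_id]].
by apply/funext => t /=; rewrite tnth_mktuple.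
Qed.

Lemma ge0_integral_lebesgue_tupleS (m : nat) (g : m.+1.-tuple RB -> \bar R) :
  measurable_fun setT g -> (forall t, 0 <= g t) ->
  \int[lebesgue_tuple R m.+1]_t g t =
  \int[lebesgue_measure]_x \int[lebesgue_tuple R m]_t g (tcons (x, t)).
Proof.
move=> mg g0; rewrite /= /lebesgue_cons ge0_integral_pushforward//; last first.
  exact: measurable_tcons.
rewrite preimage_setT fubini_tonelli1//.
  by apply: measurableT_comp => //; exact: measurable_tcons.
by move=> z; exact: g0.
Qed.

(** Induction on the dimension: Tonelli splits off the first coordinate, which contributes one
    factor [e] by the one-dimensional substitution; the other coordinates give [e ^+ m] by
    induction. *)
Lemma ge0_integral_affine_tuple (m : nat) (x : 'rV[R]_m) (e : R)
    (g : m.-tuple RB -> \bar R) : (0 < e)%R ->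
  measurable_fun setT g -> (forall t, 0 <= g t) ->
  \int[lebesgue_tuple R m]_t g t =
  (e ^+ m)%:E * \int[lebesgue_tuple R m]_t g (affine_tuple x e t).
Proof.
move=> e0; elim: m => [|m IH] in x g * => mg g0.
  rewrite expr0 mul1e; apply: eq_integral => t _; congr g.
  by rewrite tuple0 [RHS]tuple0.
have mga : measurable_fun setT (g \o affine_tuple x e).
  by apply: measurableT_comp => //; exact: measurable_affine_tuple.
rewrite !ge0_integral_lebesgue_tupleS//.
pose x' : 'rV[R]_m := \row_i (x 0 (lift ord0 i))%R.
have aE (y : RB) t : affine_tuple x e (tcons (y, t)) =
    tcons ((x 0 ord0 - e * y)%R, affine_tuple x' e t).
  apply: eq_from_tnth => i; rewrite tnth_mktuple.
  case: (unliftP ord0 i) => [j|] ->; rewrite /tcons ?tnthS/= ?tnth0//.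
  by rewrite !tnth_mktuple mxE.
have mgt y : measurable_fun setT (fun t => g (tcons (y, t))).
  apply: (measurableT_comp mg).
  by apply: measurable_cons => //; exact: measurable_id.
pose G y := \int[lebesgue_tuple R m]_t g (tcons (y, t)).
have mG : measurable_fun setT G.
  apply: (@measurable_fun_fubini_tonelli_F _ _ _ _ _ _ (g \o @tcons R m)).
    by apply: measurableT_comp => //; exact: measurable_tcons.
  by move=> z; exact: g0.
have G0 y : 0 <= G y by apply: integral_ge0.
pose H y := \int[lebesgue_tuple R m]_t g (affine_tuple x e (tcons (y, t))).
have mH : measurable_fun setT H.
  apply: (@measurable_fun_fubini_tonelli_F _ _ _ _ _ _
    ((g \o affine_tuple x e) \o @tcons R m)).
    by apply: measurableT_comp => //; exact: measurable_tcons.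
  by move=> z; exact: g0.
have H0 y : 0 <= H y by apply: integral_ge0.
rewrite (ge0_integral_affine (x 0 ord0)%R e0 mG)//.
rewrite exprS EFinM -muleA; congr (_ * _).
rewrite -/H -ge0_integralZl//; last by rewrite lee_fin exprn_ge0// ltW.
  apply: eq_integral => y _; rewrite /G /H (IH x')//.
  by congr (_ * _); apply: eq_integral => t _; rewrite aE.
by move=> y _; exact: H0.
Qed.

Local Close Scope ereal_scope.

(** * Integration of continuous functions supported in a ball *)

Section compact_support.
Variable m : nat.
Implicit Types (F G : 'rV[R]_m -> R) (r : R).
Local Notation mu := (lebesgue_tuple R m).

(** The radius is explicit and refers to the sup norm, so that the support lies in a cube and
    integrals can be bounded by its volume. *)
Definition cc r F := continuous F /\ forall w, r < `|w| -> F w = 0.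

Lemma cc_le r s F : r <= s -> cc r F -> cc s F.
Proof. by move=> rs [cF F0]; split=> // w /(le_lt_trans rs); exact: F0. Qed.

Lemma ccD r F G : cc r F -> cc r G -> cc r (fun w => F w + G w).
Proof.
move=> [cF F0] [cG G0]; split=> [w|w rw]; last by rewrite F0// G0// addr0.
exact: (cvgD (cF w) (cG w)).
Qed.

Lemma ccZ r k F : cc r F -> cc r (fun w => k * F w).
Proof.
move=> [cF F0]; split=> [w|w rw]; last by rewrite F0// mulr0.
exact: (cvgM (cvg_cst _) (cF w)).
Qed.

Lemma ccB r F G : cc r F -> cc r G -> cc r (fun w => F w - G w).
Proof.
move=> ccF /(ccZ (-1)) ccG.
by under eq_fun do rewrite -mulN1r; exact: ccD.
Qed.

Lemma cc_sum r (I : Type) (s : seq I) (F : I -> 'rV[R]_m -> R) :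
  (forall i, cc r (F i)) -> cc r (fun w => \sum_(i <- s) F i w).
Proof.
move=> ccF; elim: s => [|i s IH].
  rewrite (_ : (fun w => _) = cst 0); first by split=> // w; exact: cst_continuous.
  by apply/funext => w; rewrite big_nil.
rewrite (_ : (fun w => _) = fun w => F i w + \sum_(j <- s) F j w).
  exact: ccD.
by apply/funext => w; rewrite big_cons.
Qed.

(** The new radius comes from the triangle inequality: the norm of [e *: w] is at most that of
    [x - e *: w] plus that of [x]. *)
Lemma cc_affine r F (x : 'rV[R]_m) (e : R) : 0 < e -> cc r F ->
  cc ((r + `|x|) / e) (fun w => F (x - e *: w)).
Proof.
move=> e0 [cF F0]; split=> [w|w].
  apply: continuous_comp; last exact: cF.
  apply: (@continuousB R 'rV[R]_m); first exact: cst_continuous.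
  exact: scaler_continuous.
rewrite ltr_pdivrMr// => h; apply: F0.
have : `|e *: w| <= `|x - e *: w| + `|x|.
  rewrite -normrN -[X in `|X|](_ : x - e *: w - x = _) ?ler_normB//.
  by rewrite addrAC subrr add0r.
by rewrite normrZ (gtr0_norm e0) mulrC => h'; lra.
Qed.

Definition cube r : set (m.-tuple RB) :=
  [set t | forall i, [set` `[- r, r]] (tnth t i)].

Lemma cubeE r (t : m.-tuple RB) : 0 <= r ->
  cube r t <-> `|row_of_tuple t| <= r.
Proof.
move=> r0; rewrite normr_rV_leP//; split=> h i; have := h i.
  by rewrite /= in_itv/= !mxE ler_norml.
by rewrite /= in_itv/= !mxE ler_norml.
Qed.

Lemma measurable_cube r : measurable (cube r).
Proof.
apply: (@measurable_tuple_box m (fun=> [set` `[- r, r]])) => i.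
exact: measurable_itv.
Qed.

Lemma cube_fin r : (mu (cube r) < +oo)%E.
Proof.
rewrite -ge0_fin_numE ?measure_ge0//.
rewrite (@lebesgue_tuple_box R m (fun=> [set` `[- r, r]])) => [|i]; last first.
  exact: measurable_itv.
elim/big_ind : _ => [//|a b|i _]; first exact: fin_numM.
by rewrite lebesgue_measure_itv/=; case: ifP.
Qed.

Definition cube_volume r : R := fine (mu (cube r)).

Lemma cube_volume_ge0 r : 0 <= cube_volume r.
Proof. by rewrite fine_ge0. Qed.

Lemma cc_bounded r F : 0 <= r -> cc r F ->
  exists2 M : R, 0 <= M & forall w, `|F w| <= M.
Proof.
move=> r0 [cF F0].
pose A := [set w : 'rV[R]_m | forall i, [set` `[- r, r]] (w ord0 i)].
have cA : compact A 
  by apply: (@rV_compact R m (fun=> [set` `[- r, r]])) => i; exact: segment_compact.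
have A0 : A !=set0 by exists 0 => i; rewrite /= mxE in_itv/= oppr_le0 r0.
have cnF : {within A, continuous (fun w => `|F w|)}.
  apply: continuous_subspaceT => w.
  by apply: continuous_comp; [exact: cF|exact: norm_continuous].
have [c _ hc] := EVT_max_rV A0 cA cnF.
exists `|F c| => // w; have [wr|rw] := leP `|w| r; last by rewrite F0// normr0.
apply: hc; rewrite inE => i; rewrite /= in_itv/= -ler_norml.
exact: (normr_rV_leP w r0).1.
Qed.

(** Replaces the whole space by a set of finite measure, on which bounded measurable functions are
    integrable. *)
Lemma cc_restrict r F : 0 <= r -> cc r F ->
  (fun t => F (row_of_tuple t)) = (fun t => F (row_of_tuple t)) \_ (cube r).
Proof.
move=> r0 [_ F0]; apply/funext => t; rewrite patchE; case: ifPn => //.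
by rewrite notin_setE => /cubeE - /(_ r0)/negP; rewrite -ltNge => /F0.
Qed.

Lemma cc_integrable_cube r F : 0 <= r -> cc r F ->
  mu.-integrable (cube r) (EFin \o (fun t => F (row_of_tuple t))).
Proof.
move=> r0 ccF; apply: measurable_bounded_integrable.
- exact: measurable_cube.
- exact: cube_fin.
- by apply: measurable_funTS; apply: measurable_row_of_tuple_comp; case: ccF.
- have [M M0 FM] := cc_bounded r0 ccF.
  exists M; split; first exact: num_real.
  by move=> x Mx t _ /=; rewrite (le_trans (FM _))// ltW.
Qed.

Lemma cc_integrable r F : 0 <= r -> cc r F ->
  mu.-integrable setT (EFin \o (fun t => F (row_of_tuple t))).
Proof.
move=> r0 ccF; rewrite (cc_restrict r0 ccF).
rewrite (_ : EFin \o _ = (EFin \o (fun t => F (row_of_tuple t))) \_ (cube r)).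
  by apply/(integrable_mkcond _ (measurable_cube r)); exact: cc_integrable_cube.
by apply/funext => t; rewrite /= !patchE; case: ifP.
Qed.

Lemma integral_rVTE F :
  integral_rV setT F = \int[mu]_t F (row_of_tuple t).
Proof. by rewrite /integral_rV preimage_setT. Qed.

Lemma integral_rVD r F G : 0 <= r -> cc r F -> cc r G ->
  integral_rV setT (fun w => F w + G w) =
  integral_rV setT F + integral_rV setT G.
Proof.
by move=> r0 cF cG; rewrite !integral_rVTE RintegralD//;
  exact: (cc_integrable r0).
Qed.

Lemma integral_rVZ r k F : 0 <= r -> cc r F ->
  integral_rV setT (fun w => k * F w) = k * integral_rV setT F.
Proof.
by move=> r0 cF; rewrite !integral_rVTE RintegralZl//; exact: cc_integrable r0 cF.
Qed.

Lemma integral_rVB r F G : 0 <= r -> cc r F -> cc r G ->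
  integral_rV setT (fun w => F w - G w) =
  integral_rV setT F - integral_rV setT G.
Proof.
by move=> r0 cF cG; rewrite !integral_rVTE RintegralB//;
  exact: (cc_integrable r0).
Qed.

Lemma integral_rV_sum r (I : Type) (s : seq I) (F : I -> 'rV[R]_m -> R) :
  0 <= r -> (forall i, cc r (F i)) ->
  integral_rV setT (fun w => \sum_(i <- s) F i w) =
  \sum_(i <- s) integral_rV setT (F i).
Proof.
move=> r0 ccF; elim: s => [|i s IH].
  rewrite big_nil integral_rVTE; under eq_Rintegral do rewrite big_nil.
  by rewrite Rintegral_cst// mul0r.
rewrite big_cons -IH -(integral_rVD r0)//; last exact: cc_sum.
by congr integral_rV; apply/funext => w; rewrite big_cons.
Qed.

Lemma le_integral_rV r F M : 0 <= r -> cc r F -> (forall w, `|F w| <= M) ->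
  `|integral_rV setT F| <= M * cube_volume r.
Proof.
move=> r0 ccF FM; rewrite integral_rVTE (cc_restrict r0 ccF) -Rintegral_mkcond.
have iF := cc_integrable_cube r0 ccF.
have mC := measurable_cube r.
rewrite (le_trans (le_normr_Rintegral mC iF))//.
rewrite -Rintegral_cst//; apply: le_Rintegral => //.
  exact: integrable_norm iF.
apply: measurable_bounded_integrable => //; first exact: cube_fin.
exists `|M|; split; first exact: num_real.
by move=> x Mx t _; rewrite ltW.
Qed.

Lemma row_of_affine_tuple (x : 'rV[R]_m) (e : R) t :
  row_of_tuple (affine_tuple x e t) = x - e *: row_of_tuple t.
Proof. by apply/rowP => i; rewrite !mxE tnth_mktuple. Qed.

(** The nonnegative substitution rule is applied to the positive and the negative part;
    integrability keeps their difference well defined. *)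
Lemma integral_rV_affine r F (x : 'rV[R]_m) (e : R) : 0 < e -> 0 <= r ->
  cc r F ->
  integral_rV setT F = e ^+ m * integral_rV setT (fun w => F (x - e *: w)).
Proof.
move=> e0 r0 ccF; rewrite !integral_rVTE /Rintegral.
have r'0 : 0 <= (r + `|x|) / e by rewrite divr_ge0 ?addr_ge0// ltW.
have ccF' := cc_affine x e0 ccF.
have iF := cc_integrable r0 ccF; have iF' := cc_integrable r'0 ccF'.
pose f t : \bar R := (F (row_of_tuple t))%:E.
have mf : measurable_fun setT f by case/integrableP : iF.
have E : (\int[mu]_t f t =
    (e ^+ m)%:E * \int[mu]_t (F (x - e *: row_of_tuple t))%:E)%E.
  rewrite integralE [in RHS]integralE muleBr//.
    have fE t : (F (x - e *: row_of_tuple t))%:E = f (affine_tuple x e t).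
      by rewrite /f row_of_affine_tuple.
    congr (_ - _)%E.
      rewrite (ge0_integral_affine_tuple x e0)//.
        by congr (_ * _)%E; apply: eq_integral => t _; rewrite !funeposE fE.
      exact: measurable_funepos.
    rewrite (ge0_integral_affine_tuple x e0)//.
      by congr (_ * _)%E; apply: eq_integral => t _; rewrite !funenegE fE.
    exact: measurable_funeneg.
  apply: fin_num_adde_defl; rewrite fin_numN.
  by apply: integrable_fin_num => //; exact: integrable_funeneg.
rewrite -/(f _) E fineM//; exact: integrable_fin_num.
Qed.

End compact_support.
End lebesgue_rV.

(** * Partial derivatives, increments, and comparison of the norms *)

Section partial_derivatives.
Context {R : realType} {m : nat}.
Implicit Types (F G u : 'rV[R]_m -> R).
Local Notation "''e_' i" := (delta_mx 0 i : 'rV[R]_m) (at level 8, i at level 2).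

(** Brings directional derivatives within reach of the one-variable mean value theorem; the two
    difference quotients are the same function of [h]. *)
Lemma is_derive_line G (p v : 'rV[R]_m) (s : R) : derivable G (p + s *: v) v ->
  is_derive s (1 : R) (fun t => G (p + t *: v)) ('D_v G (p + s *: v)).
Proof.
move=> dG.
have E : (fun h : R => h^-1 *: (((fun t => G (p + t *: v)) \o shift s) (h *: 1)
      - G (p + s *: v))) =
    (fun h => h^-1 *: ((G \o shift (p + s *: v)) (h *: v) - G (p + s *: v))).
  apply/funext => h /=; congr (_ *: (G _ - _)).
  by rewrite [h *: 1]mulr1 scalerDl addrCA.
by apply: DeriveDef; rewrite /derivable /derive E.
Qed.

(** A mean value theorem for increments of either sign; for negative [a] it is applied on the
    segment from [a] to 0. *)
Lemma MVT0 (g dg : R -> R) (a : R) : (forall s, is_derive s (1 : R) g (dg s)) ->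
  exists2 c, `|c| <= `|a| & g a - g 0 = dg c * a.
Proof.
move=> dgP.
have cg : continuous g.
  by move=> s; apply/differentiable_continuous/derivable1_diffP; case: (dgP s).
have [a0|a0] := leP 0 a.
  have [c] := MVT_segment a0 (fun s _ => dgP s) (continuous_subspaceT cg).
  rewrite in_itv/= subr0 => /andP[c0 ca] E.
  by exists c => //; rewrite !ger0_norm.
have [c] := MVT_segment (ltW a0) (fun s _ => dgP s) (continuous_subspaceT cg).
rewrite in_itv/= => /andP[ac c0] E.
exists c; first by rewrite !ler0_norm ?(ltW a0)// lerN2.
by rewrite -opprB E sub0r mulrN opprK.
Qed.

(* The increment is cut into m increments parallel to the axes. *)
Lemma partial_increment G (c : 'I_m -> R) (w h : 'rV[R]_m) (d : R) :
  (forall i x, derivable G x 'e_i) ->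
  (forall i x, `|x - w| <= `|h| -> `|'D_'e_i G x - c i| <= d) ->
  `|G (w + h) - G w - \sum_i c i * h 0 i| <= m%:R * (d * `|h|).
Proof.
move=> dG Dc.
(* In [p k] the coordinates of index below [k] have already moved from [w] to [w + h]. *)
pose p k := w + \row_i (if (i < k)%N then h 0 i else 0).
have p0 : p 0%N = w by apply/rowP => i; rewrite !mxE addr0.
have pm : p m = w + h by apply/rowP => i; rewrite !mxE ltn_ord.
have pS (k : 'I_m) : p k.+1 = p k + h 0 k *: 'e_k.
  apply/rowP => i; rewrite !mxE -addrA; congr (_ + _).
  rewrite eqxx/= ltnS leq_eqVlt; have [->|ik] := eqVneq i k.
    by rewrite eqxx ltnn/= add0r mulr1.
  by rewrite (_ : (i == k :> nat) = false) ?mulr0 ?addr0//; exact/negbTE.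
have step (k : 'I_m) : `|G (p k.+1) - G (p k) - c k * h 0 k| <= d * `|h|.
  have [xi xih E] := MVT0 (h 0 k)
    (fun s => is_derive_line (dG k (p k + s *: 'e_k))).
  move: E; rewrite -pS scale0r addr0 => ->; rewrite -mulrBl normrM.
  apply: ler_pM => //; last exact: normr_rV_ge.
  (* The intermediate point differs from [w] in each coordinate by 0, by a coordinate of [h], or by
     [xi], so it stays in the sup-norm ball where the partials are controlled. *)
  apply: Dc; apply/normr_rV_leP => // i; rewrite !mxE eqxx/=.
  rewrite (_ : _ - w 0 i =
    (if (i < k)%N then h 0 i else 0) + xi * (i == k)%:R); last by ring.
  have [->|ik] := eqVneq i k.
    by rewrite ltnn add0r mulr1 (le_trans xih)// normr_rV_ge.
  by rewrite mulr0 addr0; case: ifP => _; rewrite ?normr0// normr_rV_ge.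
rewrite -pm -{1}p0 -(telescope_sumr (fun k => G (p k)))// big_mkord -sumrB.
rewrite (le_trans (ler_norm_sum _ _ _))//.
rewrite (le_trans (ler_sum _ (fun k _ => step k)))//.
by rewrite sumr_const card_ord mulr_natl.
Qed.

Lemma normr_delta_mx (i : 'I_m) : `|delta_mx 0 i : 'rV[R]_m| = 1.
Proof.
apply/eqP; rewrite eq_le; apply/andP; split.
  apply/normr_rV_leP => // j; rewrite mxE eqxx/=.
  by case: eqP => _; rewrite ?normr1 ?normr0.
by have := normr_rV_ge (delta_mx 0 i : 'rV[R]_m) i; rewrite mxE !eqxx normr1.
Qed.

Lemma near_gt_norm (r : R) (w : 'rV[R]_m) : r < `|w| ->
  \forall x \near w, r < `|x|.
Proof. exact: (cvgr_gt `|w| (@norm_continuous R 'rV[R]_m w)). Qed.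

(** Being outside the closed ball is an open condition, so [F] vanishes near such a point and its
    derivative vanishes there. *)
Lemma cc_derive r F (v : 'rV[R]_m) : cc r F -> continuous (fun x => 'D_v F x) ->
  cc r (fun x => 'D_v F x).
Proof.
move=> [cF F0] cD; split=> // w rw.
rewrite (@near_eq_derive R 'rV[R]_m R F (cst 0)) ?derive_cst//.
by near=> x; apply: F0; near: x; exact: near_gt_norm.
Unshelve. all: by end_near. Qed.

(** Asks continuity of [u] on the closed ball only, because [f] is controlled only inside [Omega];
    outside the ball the product is locally zero. *)
Lemma cc_mul r u F : (forall w, `|w| <= r -> {for w, continuous u}) -> cc r F ->
  cc r (fun w => u w * F w).
Proof.
move=> cu [cF F0]; split=> [w|w rw]; last by rewrite F0// mulr0.
have [wr|rw] := leP `|w| r; first exact: (cvgM (cu w wr) (cF w)).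
rewrite /continuous_at F0// mulr0 => A /nbhs_singleton A0.
by have := near_gt_norm rw; apply: filterS => x rx; rewrite /= F0// mulr0.
Qed.

Lemma continuous_affine_comp u (x w : 'rV[R]_m) (e : R) :
  {for x - e *: w, continuous u} ->
  {for w, continuous (fun w : 'rV[R]_m => u (x - e *: w))}.
Proof.
move=> cu; apply: continuous_comp; last exact: cu.
apply: (@continuousB R 'rV[R]_m); first exact: cst_continuous.
exact: scaler_continuous.
Qed.

Lemma cc_shift r s F (k : 'rV[R]_m) : `|k| <= s -> cc r F ->
  cc (r + s) (fun w => F (w + k)).
Proof.
move=> ks [cF F0]; split=> [w|w rw].
  apply: continuous_comp; last exact: cF.
  by apply: (@continuousD R 'rV[R]_m) => //; exact: cst_continuous.
apply: F0; have := ler_normB (w + k) k; rewrite addrK.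
by lra.
Qed.

Lemma compact_bounded_for (K : set 'rV[R]_m) u : compact K ->
  (forall w, K w -> {for w, continuous u}) ->
  exists2 M : R, 0 <= M & forall w, K w -> `|u w| <= M.
Proof.
move=> cK cu; have [->|/set0P K0] := eqVneq K set0; first by exists 0.
have cnu : {within K, continuous (fun w => `|u w|)}.
  apply: continuous_in_subspaceT => w /set_mem Kw.
  by apply: continuous_comp; [exact: cu|exact: norm_continuous].
have [c _ hc] := EVT_max_rV K0 cK cnu.
by exists `|u c| => // w Kw; apply: hc; exact/mem_set.
Qed.

Lemma compact_cball (r : R) : 0 <= r -> compact [set w : 'rV[R]_m | `|w| <= r].
Proof.
move=> r0; rewrite (_ : mkset _ =
    [set w : 'rV[R]_m | forall i, [set` `[- r, r]] (w ord0 i)]).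
  by apply: (@rV_compact R m (fun=> [set` `[- r, r]])) => i; exact: segment_compact.
apply/seteqP; split=> w /=.
  by move=> /(normr_rV_leP w r0) wr i; rewrite in_itv/= -ler_norml.
move=> wr; apply/(normr_rV_leP w r0) => i.
by have := wr i; rewrite in_itv/= -ler_norml.
Qed.

(** This and the next lemma let every estimate run in the sup norm; the crude factor [k], in place
    of its square root, only affects constants. *)
Lemma eucl_norm_ge (k : nat) (v : 'rV[R]_k) : `|v| <= eucl_norm v.
Proof.
apply/normr_rV_leP => [|i]; first exact: sqrtr_ge0.
rewrite -sqrtr_sqr ler_wsqrtr// (bigD1 i)//= lerDl.
by apply: sumr_ge0 => j _; exact: sqr_ge0.
Qed.

Lemma eucl_norm_le (k : nat) (v : 'rV[R]_k) : eucl_norm v <= k%:R * `|v|.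
Proof.
have k0 : 0 <= k%:R * `|v| by rewrite mulr_ge0.
rewrite -(ler_pXn2r (n := 2)) ?nnegrE ?sqrtr_ge0// sqr_sqrtr; last first.
  by apply: sumr_ge0 => j _; exact: sqr_ge0.
have vi i : v 0 i ^+ 2 <= `|v| ^+ 2.
  by rewrite -[leLHS]real_normK ?num_real// ler_pXn2r ?nnegrE// normr_rV_ge.
rewrite (le_trans (ler_sum _ (fun i _ => vi i)))// sumr_const card_ord.
rewrite -[_ *+ k]mulr_natl exprMn ler_wpM2r ?sqr_ge0// -natrX ler_nat.
by case: k {v vi k0} => // k; rewrite expnS expn1 leq_pmull.
Qed.

End partial_derivatives.

(** A quadratic remainder is little-o of the increment, and uniqueness of the differential
    identifies it with [df]. *)
Lemma diff_of_quadratic (R : realType) (V W : normedModType R) (g : V -> W)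
    (df : {linear V -> W}) (x : V) (C e : R) : continuous df -> 0 < e ->
  (forall h, `|h| <= e -> `|g (x + h) - g x - df h| <= C * `|h| ^+ 2) ->
  differentiable g x /\ 'd g x = df :> (V -> W).
Proof.
move=> cdf e0 HC.
have Ao : g \o shift x = cst (g x) + df +o_ 0 id.
  (* A positive divisor, whatever the sign of [C]. *)
  have D0 : 0 < `|C| + 1 by rewrite ltr_wpDl.
  apply/eqaddoP => d d0; near=> h.
  have hx : `|h| <= e.
    near: h; apply/nbhs_ballP; exists e => //= y.
    by rewrite -ball_normE/= sub0r normrN => /ltW.
  rewrite /= !fctE/= opprD addrA [h + x]addrC (le_trans (HC _ hx))//.
  rewrite expr2 mulrA ler_wpM2r//.
  rewrite (@le_trans _ _ ((`|C| + 1) * `|h|))//.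
    by rewrite ler_wpM2r// (le_trans (ler_norm C))// lerDl.
  rewrite mulrC -ler_pdivlMr//; near: h; apply/nbhs_ballP.
  exists (d / (`|C| + 1)) => /=; first by rewrite divr_gt0.
  by move=> y; rewrite -ball_normE/= sub0r normrN => /ltW.
have dE := diff_unique cdf Ao.
by split=> //; apply/diff_locallyP; rewrite dE.
Unshelve. all: by end_near. Qed.

Section differential.
Context {R : realType} {m k : nat}.

Lemma mulmxr_continuous (A : 'M[R]_(m, k)) :
  continuous (mulmxr A : 'rV[R]_m -> 'rV[R]_k).
Proof.
apply/linear_bounded_continuous/linear_boundedP.
have A0 : 0 <= \sum_i \sum_j `|A i j|.
  by rewrite sumr_ge0// => i _; rewrite sumr_ge0.
near=> r => v /=.
rewrite (@le_trans _ _ ((\sum_i \sum_j `|A i j|) * `|v|))//; last first.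
  by rewrite ler_wpM2r//; near: r; exact: nbhs_pinfty_ge.
apply/normr_rV_leP => [|j]; first by rewrite mulr_ge0.
rewrite mxE (le_trans (ler_norm_sum _ _ _))// mulr_suml ler_sum// => i _.
rewrite normrM mulrC ler_pM ?normr_rV_ge// (bigD1 j)//= lerDl.
by rewrite sumr_ge0.
Unshelve. all: by end_near. Qed.

End differential.

(** * Linear forms on row vectors *)

Section linear_forms.
Context {R : realType} {k : nat}.

(** A predicate on plain functions, so that coordinates and [contact_form q] are treated alike
    without bundling. *)
Definition linform (l : 'rV[R]_k -> R) :=
  forall a u v, l (a *: u + v) = a * l u + l v.

Lemma linform_coord (i : 'I_k) : linform (fun v : 'rV[R]_k => v 0 i).
Proof. by move=> a u v; rewrite !mxE. Qed.

Lemma linformB (l : 'rV[R]_k -> R) u v : linform l ->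
  l (u - v) = l u - l v.
Proof. by move=> ll; rewrite addrC -scaleN1r ll mulN1r addrC. Qed.

Lemma linformZ (l : 'rV[R]_k -> R) a v : linform l ->
  l (a *: v) = a * l v.
Proof.
move=> ll; have l0 : l 0 = 0 by rewrite -(subrr v) linformB// subrr.
by rewrite -[a *: v]addr0 ll l0 addr0.
Qed.

Lemma linformE l v : linform l -> l v = \sum_i v 0 i * l (delta_mx 0 i).
Proof.
move=> ll; have l0 : l 0 = 0 by rewrite -(subrr 0) linformB// subrr.
rewrite [v in LHS]row_sum_delta.
by elim/big_rec2 : _ => // i y1 y2 _ <-; rewrite ll.
Qed.

Lemma linform_sum (l : 'rV[R]_k -> R) (I : Type) (s : seq I)
    (a : I -> R) (F : I -> 'rV[R]_k) : linform l ->
  l (\sum_(i <- s) a i *: F i) = \sum_(i <- s) a i * l (F i).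
Proof.
move=> ll; elim: s => [|i s IH]; last by rewrite !big_cons ll IH.
by rewrite !big_nil -(subrr 0) linformB// subrr.
Qed.

Lemma linform_continuous (l : 'rV[R]_k -> R) : linform l ->
  continuous l.
Proof.
move=> ll x.
pose S := \sum_i `|l (delta_mx 0 i)|.
have S0 : 0 <= S by apply: sumr_ge0.
have lS v : `|l v| <= S * `|v|.
  rewrite linformE// (le_trans (ler_norm_sum _ _ _))// mulr_suml ler_sum// => i _.
  by rewrite normrM mulrC ler_wpM2l// normr_rV_ge.
apply/(@cvgrPdist_le _ _ _ (nbhs x)) => d d0.
have S1 : 0 < S + 1 by rewrite ltr_wpDl.
apply/nbhs_ballP; exists (d / (S + 1)) => /=; first by rewrite divr_gt0.
move=> y; rewrite -ball_normE/= => xy.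
rewrite -linformB// (le_trans (lS _))//.
rewrite (@le_trans _ _ ((S + 1) * `|x - y|))//; first by rewrite ler_wpM2r// lerDl.
by rewrite mulrC -ler_pdivlMr// ltW.
Qed.

(** A linear form commutes with difference quotients and, being continuous, with their limit. *)
Lemma linform_derive (m : nat) (l : 'rV[R]_k -> R) (F : 'rV[R]_m -> 'rV[R]_k)
    (y v : 'rV[R]_m) : linform l -> differentiable F y ->
  derivable (l \o F) y v /\ 'D_v (l \o F) y = l ('d F y v).
Proof.
move=> ll dF; rewrite -deriveE//.
have cF : h^-1 *: ((F \o shift y) (h *: v) - F y) @[h --> 0^'] --> 'D_v F y.
  exact: diff_derivable.
have cl : {for 'D_v F y, continuous l} by exact: linform_continuous.
have clF : h^-1 *: (((l \o F) \o shift y) (h *: v) - (l \o F) y) @[h --> 0^']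
    --> l ('D_v F y).
  rewrite (_ : (fun h : R => _) =
      l \o (fun h : R => h^-1 *: ((F \o shift y) (h *: v) - F y))).
    exact: continuous_cvg.
  by apply/funext => h /=; rewrite linformZ// linformB.
by split; [exact: cvgP clF|exact: cvg_lim clF].
Qed.

End linear_forms.

(** * Mollifiers: Taylor expansion and differentiation of the convolution *)

Section mollifier_theory.
Context {R : realType} {m : nat}.
Variable eta : 'rV[R]_m -> R.
Hypothesis eta_mollifier : mollifier eta.
Local Notation "''e_' i" := (delta_mx 0 i : 'rV[R]_m) (at level 8, i at level 2).
Local Notation "''d_' i" := (fun x => 'D_'e_i eta x) (at level 8, i at level 2).

Lemma eta_smooth : smooth eta. Proof. by case: eta_mollifier => -[]. Qed.

Lemma eta_cc : cc 1 eta.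
Proof.
split; first exact: (eta_smooth [::]).1.
move=> w w1; apply/eqP; apply: contraTT w1 => etaw; rewrite -leNgt.
rewrite (le_trans (eucl_norm_ge _))// ltW//.
by have [[_ _ sub] _ _] := eta_mollifier; apply: sub; exact: subset_closure.
Qed.

Lemma partial_eta_cc i : cc 1 'd_i.
Proof. by apply: (cc_derive eta_cc); exact: (eta_smooth [:: i]).1. Qed.

Lemma partial2_eta_cc i j : cc 1 (fun x => 'D_'e_j 'd_i x).
Proof.
by apply: (cc_derive (partial_eta_cc i)); exact: (eta_smooth [:: j; i]).1.
Qed.

(** [partial_increment] with slopes [c = 0]; the sum of the bounds of all second partials serves as
    a common [d]. *)
Lemma partial_eta_lipschitz : exists2 L : R, 0 <= L &
  forall i w x, `|'d_i x - 'd_i w| <= L * `|x - w|.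
Proof.
have /choice[M HM] : forall ij : 'I_m * 'I_m, exists M : R,
    0 <= M /\ forall w, `|'D_'e_(ij.2) 'd_(ij.1) w| <= M.
  by move=> [i j]; have [M ? ?] := cc_bounded ler01 (partial2_eta_cc i j); exists M.
have M0 : 0 <= \sum_ij M ij by apply: sumr_ge0 => ij _; case: (HM ij).
exists (m%:R * \sum_ij M ij) => [|i w x]; first by rewrite mulr_ge0.
have := @partial_increment R m 'd_i (fun=> 0) w (x - w) (\sum_ij M ij).
rewrite [w + _]addrC subrK (_ : \sum_j 0 * _ = 0); last first.
  by apply: big1 => j _; rewrite mul0r.
rewrite subr0 mulrA.
apply=> [j y|j y _]; first exact: (eta_smooth [:: i]).2.
rewrite subr0; have [_ /(_ y) /le_trans] := HM (i, j); apply.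
by rewrite (bigD1 (i, j))//= lerDl; apply: sumr_ge0 => ij _; case: (HM ij).
Qed.

(** [partial_increment] with the partials at [w] as slopes: by the Lipschitz bound [d] is
    proportional to the norm of [h], uniformly in [w]. *)
Lemma eta_taylor : exists2 L : R, 0 <= L & forall w h,
  `|eta (w + h) - eta w - \sum_i 'd_i w * h 0 i| <= L * `|h| ^+ 2.
Proof.
have [L L0 HL] := partial_eta_lipschitz.
exists (m%:R * L) => [|w h]; first by rewrite mulr_ge0.
rewrite expr2 -mulrA [L * _]mulrA.
apply: partial_increment => [i x|i x xwh]; first exact: (eta_smooth [::]).2.
by rewrite (le_trans (HL _ _ _))// ler_wpM2l.
Qed.

Lemma eta_integral : integral_rV setT eta = 1.
Proof. by case: eta_mollifier. Qed.

Section smoothing.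
Variables (Omega : set 'rV[R]_m) (u : 'rV[R]_m -> R).
Hypothesis cu : forall y, Omega y -> {for y, continuous u}.

Definition cball_sub (x : 'rV[R]_m) (r : R) := forall y, `|x - y| <= r -> Omega y.

Definition convolve (e : R) (x : 'rV[R]_m) : R :=
  integral_rV Omega (fun y => u y * dilate eta e (x - y)).

(** The convolution after the substitution y = x - e w. With [psi = eta] it is the mollification,
    and with a partial derivative of [eta] it is [e] times the corresponding partial of the
    mollification, as long as the ball of radius [2 * e] about [x] lies in [Omega]. *)
Definition smear (x : 'rV[R]_m) (e : R) (psi : 'rV[R]_m -> R) : R :=
  integral_rV setT (fun w => u (x - e *: w) * psi w).

Lemma cc_smear r x e psi : 0 < e -> cball_sub x (r * e) -> cc r psi ->
  cc r (fun w => u (x - e *: w) * psi w).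
Proof.
move=> e0 xO; apply: cc_mul => w wr.
apply: continuous_affine_comp; apply: cu; apply: xO.
rewrite opprB addrC subrK normrZ gtr0_norm// mulrC.
by rewrite ler_wpM2r// ltW.
Qed.

(** The increment is moved from [u] into [eta], which is the smooth factor. The shift enlarges the
    support radius from 1 to 2, hence the ball of radius [2 * e]. *)
Lemma convolve_shift (x h : 'rV[R]_m) e : 0 < e -> cball_sub x (2 * e) ->
  `|h| <= e ->
  convolve e (x + h) = smear x e (fun w => eta (w + e^-1 *: h)).
Proof.
move=> e0 xO he.
have k1 : `|e^-1 *: h| <= 1.
  by rewrite normrZ gtr0_norm ?invr_gt0// mulrC ler_pdivrMr// mul1r.
have ccP : cc 2 (fun w => u (x - e *: w) * eta (w + e^-1 *: h)).
  apply: cc_smear => //.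
  by rewrite (_ : 2 = 1 + 1 :> R)//; exact: cc_shift k1 eta_cc.
set P := (fun w => _) in ccP.
have e'0 : 0 < e^-1 by rewrite invr_gt0.
have ccP' := cc_affine (e^-1 *: x) e'0 ccP.
have r'0 : 0 <= (2 + `|e^-1 *: x|) / e^-1 by rewrite divr_ge0 ?addr_ge0// ltW.
(* Here w = (x - y) / e; the Jacobian becomes the normalising factor of [dilate]. *)
rewrite /smear -/P (integral_rV_affine (e^-1 *: x) e'0 _ ccP)//.
rewrite -(integral_rVZ _ r'0 ccP') integral_rVTE /convolve /integral_rV.
rewrite Rintegral_mkcond; apply: eq_Rintegral => t _; rewrite patchE.
have -> : forall y, e^-1 ^+ m * P (e^-1 *: x - e^-1 *: y) =
    u y * dilate eta e (x + h - y).
  move=> y; rewrite /P /dilate scalerBr !scalerA divff ?gt_eqF// !scale1r.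
  rewrite opprB addrC subrK mulrCA exprVn; congr (_ * (_ * eta _)).
  by rewrite !scalerBr scalerDr addrAC.
case: ifPn => //; rewrite notin_setE/= => nO.
(* A point outside [Omega] is farther than [2 * e] from [x], hence farther than [e] from [x + h],
   beyond the support of the kernel. *)
suff -> : dilate eta e (x + h - row_of_tuple t) = 0 by rewrite mulr0.
rewrite /dilate (eta_cc.2) ?mulr0//.
rewrite normrZ gtr0_norm// mulrC ltr_pdivlMr// mul1r ltNge.
apply/negP => le_e; apply: nO; apply: xO; rewrite -/(row_of_tuple t).
rewrite (_ : x - row_of_tuple t = x + h - row_of_tuple t - h).
  by rewrite (le_trans (ler_normB _ _))//; lra.
by rewrite [RHS]addrAC addrK.
Qed.

Lemma convolveE (x : 'rV[R]_m) e : 0 < e -> cball_sub x (2 * e) ->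
  convolve e x = smear x e eta.
Proof.
move=> e0 xO; rewrite -[x in LHS]addr0 convolve_shift ?normr0 ?ltW//.
by congr (smear x e _); apply/funext => w; rewrite scaler0 addr0.
Qed.

(** Differentiation under the integral: [eta_taylor] is integrated against [u], which is bounded on
    the relevant ball. *)
Lemma convolve_taylor (x : 'rV[R]_m) e : 0 < e -> cball_sub x (2 * e) ->
  exists2 C : R, 0 <= C & forall h, `|h| <= e ->
  `|convolve e (x + h) - convolve e x -
    \sum_i h 0 i * (e^-1 * smear x e 'd_i)| <= C * `|h| ^+ 2.
Proof.
move=> e0 xO.
have [L L0 HL] := eta_taylor.
have cux (w : 'rV[R]_m) : `|w| <= 2 ->
    {for w, continuous (fun w : 'rV[R]_m => u (x - e *: w))}.
  move=> w2; apply: continuous_affine_comp; apply: cu; apply: xO.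
  rewrite opprB addrC subrK normrZ gtr0_norm// mulrC.
  by rewrite ler_wpM2r// ltW.
have [M M0 HM] := compact_bounded_for (compact_cball (ler0n R 2)) cux.
have V0 := cube_volume_ge0 (R := R) m 2.
have ei0 : 0 <= e^-1 by rewrite invr_ge0 ltW.
exists (M * L * e^-1 ^+ 2 * cube_volume (R := R) m 2).
  by rewrite !mulr_ge0.
move=> h he; rewrite convolve_shift// convolveE//.
have k1 : `|e^-1 *: h| <= 1.
  by rewrite normrZ gtr0_norm ?invr_gt0// mulrC ler_pdivrMr// mul1r.
have cc2 psi : cc 2 psi -> cc 2 (fun w => u (x - e *: w) * psi w).
  exact: cc_mul.
have le12 : 1 <= 2 :> R by rewrite ler1n.
have cA : cc 2 (fun w => u (x - e *: w) * eta (w + e^-1 *: h)).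
  by apply: cc2; rewrite (_ : 2 = 1 + 1 :> R)//; exact: cc_shift k1 eta_cc.
have cB : cc 2 (fun w => u (x - e *: w) * eta w).
  exact/cc2/(cc_le le12)/eta_cc.
have cD i : cc 2 (fun w => u (x - e *: w) * 'd_i w).
  exact/cc2/(cc_le le12)/partial_eta_cc.
have cZD i := ccZ (h 0 i * e^-1) (cD i).
rewrite (_ : \sum_i _ = integral_rV setT (fun w => \sum_i
    (h 0 i * e^-1) * (u (x - e *: w) * 'd_i w))); last first.
  rewrite (@integral_rV_sum _ _ 2)//; apply: eq_bigr => i _.
  by rewrite mulrA /smear (integral_rVZ _ _ (cD i)).
have cS := cc_sum (index_enum 'I_m) cZD.
have cAB := ccB cA cB.
rewrite /smear -(integral_rVB _ cA cB)// -(integral_rVB _ cAB cS)//.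
have cABS := ccB cAB cS.
rewrite -mulrA [_ * `|h| ^+ 2]mulrC mulrA.
apply: le_integral_rV => // w.
(* [M] bounds [u] only where |w| is at most 2; beyond that the whole integrand is zero. *)
have [w2|w2] := leP `|w| 2; last by rewrite cABS.2// normr0 !mulr_ge0.
rewrite (_ : _ - _ = u (x - e *: w) * (eta (w + e^-1 *: h) - eta w -
    \sum_i 'd_i w * (e^-1 *: h) 0 i)); last first.
  rewrite !mulrBr; congr (_ - _ - _).
  by rewrite mulr_sumr; apply: eq_bigr => i _; rewrite !mxE; ring.
rewrite normrM -!mulrA ler_pM ?HM// (le_trans (HL _ _))//.
by rewrite normrZ gtr0_norm ?invr_gt0// exprMn [e^-1 ^+ 2]expr2 -[_ / e * _]mulrA.
Qed.

End smoothing.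
(* The convolution of eta with the constant 1 is constant. *)
Lemma partial_eta_integral i : integral_rV setT 'd_i = 0.
Proof.
pose u (y : 'rV[R]_m) : R := 1.
have cu y : setT y -> {for y, continuous u} by move=> _; exact: cst_continuous.
have ball_sub x r : cball_sub setT x r by [].
have smearE x psi : smear u x 1 psi = integral_rV setT psi.
  by congr integral_rV; apply/funext => w; rewrite mul1r.
have [C C0 HC] := convolve_taylor cu (ltr01 : 0 < 1 :> R) (ball_sub 0 _).
(* For [u = 1] both convolutions equal the integral of [eta], so the Taylor bound at [t] times the
   [i]-th basis vector reduces to t |I| <= C t^2, where I is the integral of the partial. *)
have bound (t : R) : 0 < t <= 1 -> `|integral_rV setT 'd_i| <= C * t.
  move=> /andP[t0 t1].
  have := HC (t *: 'e_i).
  rewrite normrZ normr_delta_mx mulr1 gtr0_norm// => /(_ t1).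
  rewrite !(convolveE cu)// !smearE subrr sub0r normrN (bigD1 i)//= big1 => [|j ji].
    rewrite addr0 !mxE !eqxx mulr1 invr1 mul1r smearE normrM gtr0_norm//.
    by rewrite expr2 mulrA [t * _]mulrC ler_pM2r.
  by rewrite !mxE (negbTE ji) mulr0 mul0r.
apply/eqP; rewrite -normr_le0; apply/ler_addgt0Pl => d d0; rewrite addr0.
have [C1|C1] := leP C d.
  by rewrite (le_trans (bound 1 _)) ?ltr01 ?lexx// mulr1.
have C'0 : 0 < C by exact: lt_trans C1.
rewrite (le_trans (bound (d / C) _))//; last by rewrite mulrC divfK ?gt_eqF.
by rewrite divr_gt0//= ler_pdivrMr// mul1r ltW.
Qed.

(** * Mollification of vector-valued maps *)

Section vector_smoothing.
Variables (k : nat) (Omega : set 'rV[R]_m) (f : 'rV[R]_m -> 'rV[R]_k).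
Hypothesis cf : forall y, Omega y -> {for y, continuous f}.

Let cfi i y : Omega y -> {for y, continuous (fun y => f y 0 i)}.
Proof.
move=> Oy; apply: (@continuous_comp _ _ _ f (fun v : 'rV[R]_k => v 0 i)).
  exact: cf.
exact: coord_continuous.
Qed.

Definition smearv (x : 'rV[R]_m) (e : R) (psi : 'rV[R]_m -> R) : 'rV[R]_k :=
  \row_i smear (fun y => f y 0 i) x e psi.

Lemma mollifyE (x : 'rV[R]_m) e : 0 < e -> cball_sub Omega x (2 * e) ->
  mollify eta Omega f e x = smearv x e eta.
Proof.
by move=> e0 xO; apply/rowP => i; rewrite !mxE -(convolveE (@cfi i) e0 xO).
Qed.

Lemma smearv_linform l x e psi : 0 < e -> cball_sub Omega x e -> cc 1 psi ->
  linform l ->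
  cc 1 (fun w => l (f (x - e *: w)) * psi w) /\
  l (smearv x e psi) = integral_rV setT (fun w => l (f (x - e *: w)) * psi w).
Proof.
move=> e0 xO cpsi ll.
have ci i : cc 1 (fun w => f (x - e *: w) 0 i * psi w).
  by apply: (cc_smear (@cfi i)) => //; rewrite mul1r.
have ciZ i := ccZ (l (delta_mx 0 i)) (ci i).
have E : (fun w => l (f (x - e *: w)) * psi w) = (fun w =>
    \sum_i l (delta_mx 0 i) * (f (x - e *: w) 0 i * psi w)).
  apply/funext => w; rewrite linformE// mulr_suml; apply: eq_bigr => i _; ring.
rewrite E; split; first exact: cc_sum.
rewrite (@integral_rV_sum _ _ 1)// linformE//; apply: eq_bigr => i _.
by rewrite (integral_rVZ _ _ (ci i))// mxE mulrC.
Qed.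

(** Used in two ways: for [psi = eta], of integral 1, it bounds the distance from [f] to its
    mollification; for a partial of [eta], of integral 0, it bounds a derivative by the oscillation
    of [l \o f] alone. *)
Lemma smearv_near l x e psi M B c : 0 < e -> cball_sub Omega x e -> cc 1 psi ->
  (forall w, `|psi w| <= M) -> linform l ->
  (forall y, `|x - y| <= e -> `|l (f y) - c| <= B) ->
  `|l (smearv x e psi) - c * integral_rV setT psi| <= B * M * cube_volume m 1.
Proof.
move=> e0 xO cpsi psiM ll lB.
have [cl ->] := smearv_linform e0 xO cpsi ll.
rewrite -(integral_rVZ _ _ cpsi)// -(integral_rVB _ cl (ccZ c cpsi))//.
have cB := ccB cl (ccZ c cpsi).
have B0 : 0 <= B.
  apply: le_trans (normr_ge0 (l (f x) - c)) (lB x _).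
  by rewrite subrr normr0 ltW.
have M0 : 0 <= M by rewrite (le_trans _ (psiM 0)).
apply: le_integral_rV => // w.
have [w1|w1] := leP `|w| 1; last by rewrite cB.2// normr0 mulr_ge0.
rewrite -mulrBl normrM ler_pM//; apply: lB.
by rewrite opprB addrC subrK normrZ gtr0_norm// ler_piMr// ltW.
Qed.

(** Both integrals use the same displacements, so a modulus of continuity passes to the
    mollification with a constant independent of [e]. *)
Lemma smearv_diff l x y e psi M B : 0 < e -> 0 <= B ->
  cball_sub Omega x e -> cball_sub Omega y e -> cc 1 psi ->
  (forall w, `|psi w| <= M) -> linform l ->
  (forall w, `|w| <= e -> `|l (f (x - w)) - l (f (y - w))| <= B) ->
  `|l (smearv x e psi) - l (smearv y e psi)| <= B * M * cube_volume m 1.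
Proof.
move=> e0 B0 xO yO cpsi psiM ll lB.
have [clx ->] := smearv_linform e0 xO cpsi ll.
have [cly ->] := smearv_linform e0 yO cpsi ll.
rewrite -(integral_rVB _ clx cly)//.
have cB := ccB clx cly.
have M0 : 0 <= M by rewrite (le_trans _ (psiM 0)).
apply: le_integral_rV => // w.
have [w1|w1] := leP `|w| 1; last by rewrite cB.2// normr0 mulr_ge0.
rewrite -mulrBl normrM ler_pM//; apply: lB.
by rewrite normrZ gtr0_norm// ler_piMr// ltW.
Qed.

(** Coordinatewise this is [convolve_taylor]; the sum of the coordinate constants gives one
    quadratic remainder, which identifies the differential with the matrix [A]. *)
Lemma mollify_diff (x : 'rV[R]_m) e : 0 < e -> cball_sub Omega x (2 * e) ->
  differentiable (mollify eta Omega f e) x /\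
  forall v, 'd (mollify eta Omega f e) x v =
    \sum_j v 0 j *: (e^-1 *: smearv x e 'd_j).
Proof.
move=> e0 xO.
pose A : 'M[R]_(m, k) := \matrix_(j, i) (e^-1 * smear (fun y => f y 0 i) x e 'd_j).
have AE v : v *m A = \sum_j v 0 j *: (e^-1 *: smearv x e 'd_j).
  by apply/rowP => i; rewrite !mxE summxE; apply: eq_bigr => j _; rewrite !mxE.
have /choice[C HC] : forall i, exists C : R, 0 <= C /\ forall h, `|h| <= e ->
    `|(mollify eta Omega f e (x + h) - mollify eta Omega f e x - h *m A) 0 i|
      <= C * `|h| ^+ 2.
  move=> i; have [C C0 HC] := convolve_taylor (@cfi i) e0 xO.
  exists C; split=> // h he; rewrite !mxE.
  by under eq_bigr do rewrite mxE; exact: HC.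
have SC0 : 0 <= \sum_i C i by apply: sumr_ge0 => i _; case: (HC i).
have [|dg dgE] := @diff_of_quadratic R _ _ (mollify eta Omega f e)
   (mulmxr A) x (\sum_i C i) e (@mulmxr_continuous R m k A) e0.
  move=> h he; apply/normr_rV_leP => [|i]; first by rewrite mulr_ge0 ?sqr_ge0.
  have [_ /(_ h he) /le_trans] := HC i; apply.
  rewrite ler_wpM2r ?sqr_ge0// (bigD1 i)//= lerDl.
  by apply: sumr_ge0 => j _; case: (HC j).
by split=> // v; rewrite dgE /= AE.
Qed.

End vector_smoothing.

End mollifier_theory.

(** * Algebra of the contact form and the Korányi metric *)

Section heisenberg_algebra.
Context {R : realType} {n : nat}.
Local Notation H := 'rV[R]_(n.*2.+1).
Implicit Types (p q u v : H).

(** The standard symplectic form of R^(2n), evaluated on horizontal coordinates. *)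
Definition symp p v : R := \sum_j (xc p j * yc v j - yc p j * xc v j).

Lemma contact_formE p v : contact_form p v = tc v + 2 * symp p v.
Proof. by []. Qed.

Lemma sympBl p q v : symp (p - q) v = symp p v - symp q v.
Proof.
rewrite /symp -sumrB; apply: eq_bigr => j _; rewrite /xc /yc !mxE; ring.
Qed.

Lemma symp_linform p a u v : symp p (a *: u + v) = a * symp p u + symp p v.
Proof.
rewrite /symp mulr_sumr -big_split/=; apply: eq_bigr => j _.
rewrite /xc /yc !mxE; ring.
Qed.

Lemma contact_linform q : linform (@contact_form R n q).
Proof.
by move=> a u v; rewrite !contact_formE symp_linform /tc !mxE; ring.
Qed.

(** A change of base point costs a symplectic term, which is the source both of the additivity
    defect and of every mollification error. *)
Lemma contact_formBl p q v :
  contact_form p v = contact_form q v + 2 * symp (p - q) v.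
Proof. rewrite !contact_formE sympBl; ring. Qed.

Lemma hprojB p q : hproj (p - q) = hproj p - hproj q.
Proof. by apply/rowP => i; rewrite !mxE. Qed.

Lemma hproj_coord i v (i2n : (i < n.*2)%N) :
  v 0 (inord i) = hproj v 0 (Ordinal i2n).
Proof.
by rewrite mxE; congr (v 0 _); apply/val_inj; rewrite /= inordK// ltnS ltnW.
Qed.

Lemma normr_xc v j : `|xc v j| <= `|hproj v|.
Proof.
have j2n : (j.*2 < n.*2)%N by rewrite ltn_double.
by rewrite /xc (hproj_coord v j2n) normr_rV_ge.
Qed.

Lemma normr_yc v j : `|yc v j| <= `|hproj v|.
Proof.
have j2n : (j.*2.+1 < n.*2)%N by rewrite ltn_Sdouble.
by rewrite /yc (hproj_coord v j2n) normr_rV_ge.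
Qed.

Lemma normr_symp p v (a b : R) : `|hproj p| <= a -> `|hproj v| <= b ->
  `|2 * symp p v| <= 4 * n%:R * a * b.
Proof.
move=> pa vb; have a0 : 0 <= a by exact: le_trans pa.
have t j : `|xc p j * yc v j - yc p j * xc v j| <= 2 * (a * b).
  rewrite mulrDl mul1r (le_trans (ler_normB _ _))// lerD// normrM ler_pM//.
  - exact: le_trans (normr_xc _ _) pa.
  - exact: le_trans (normr_yc _ _) vb.
  - exact: le_trans (normr_yc _ _) pa.
  - exact: le_trans (normr_xc _ _) vb.
have : `|symp p v| <= n%:R * (2 * (a * b)).
  rewrite (le_trans (ler_norm_sum _ _ _))//.
  rewrite (le_trans (ler_sum _ (fun j _ => t j)))// sumr_const card_ord.
  by rewrite -[_ *+ n]mulr_natl.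
rewrite normrM [`|2|]ger0_norm// -(ler_pM2l (ltr0Sn R 1)) => /le_trans; apply.
by rewrite le_eqVlt; apply/orP; left; apply/eqP; ring.
Qed.

Lemma normr_hproj v : `|hproj v| <= `|v|.
Proof. by apply/normr_rV_leP => // i; rewrite mxE normr_rV_ge. Qed.

Lemma normr_contact_form p v :
  `|contact_form p v| <= (1 + 4 * n%:R * `|p|) * `|v|.
Proof.
rewrite contact_formE (le_trans (ler_normD _ _))// [leRHS]mulrDl mul1r.
by rewrite lerD ?normr_rV_ge// normr_symp ?normr_hproj.
Qed.

(** One-sided continuity in both points; it transfers a bound from the mollified map to [f] as eps
    tends to 0. *)
Lemma contact_form_perturb p q (d : R) : 0 < d -> exists2 t : R, 0 < t &
  forall p' q', `|p' - p| <= t -> `|q' - q| <= t ->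
  `|contact_form q (p - q)| <= `|contact_form q' (p' - q')| + d.
Proof.
move=> d0.
(* The error per unit of [t]: the first term comes from changing the vector [p - q], the second from
   changing the base point, with |p' - q'| <= |p - q| + 2 because [t <= 1]. *)
pose Q := 2 * (1 + 4 * n%:R * `|q|) + 4 * n%:R * (`|p - q| + 2).
have Q0 : 0 <= Q by rewrite addr_ge0// !mulr_ge0// addr_ge0// !mulr_ge0.
have Q1 : 0 < Q + 1 by rewrite ltr_wpDl.
exists (Num.min 1 (d / (Q + 1))); first by rewrite lt_min ltr01 divr_gt0.
move=> p' q'; set t := Num.min _ _ => pt qt.
have t0 : 0 <= t by exact: le_trans pt.
have t1 : t <= 1 by rewrite /t ge_min lexx.
have tQ : t * Q <= d.
  rewrite (@le_trans _ _ (d / (Q + 1) * (Q + 1)))//; last by rewrite divfK ?gt_eqF.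
  by rewrite ler_pM// ?lerDl// /t ge_min lexx orbT.
have pq : `|p' - q' - (p - q)| <= 2 * t.
  rewrite (_ : _ - _ = (p' - p) - (q' - q)); last first.
    by apply/rowP => i; rewrite !mxE; ring.
  by rewrite (le_trans (ler_normB _ _))// mulrDl !mul1r lerD.
have pq' : `|p' - q'| <= `|p - q| + 2.
  rewrite -[p' - q'](subrK (p - q)) addrC (le_trans (ler_normD _ _))// lerD2l.
  by rewrite (le_trans pq)// ler_piMr.
have -> : contact_form q (p - q) = contact_form q' (p' - q') +
    (contact_form q ((p - q) - (p' - q')) + 2 * symp (q - q') (p' - q')).
  rewrite [X in _ = _ + (X + _)](linformB _ _ (contact_linform q)).
  by rewrite (contact_formBl q q' (p' - q' : H)); ring.
rewrite (le_trans (ler_normD _ _))// lerD2l (le_trans (ler_normD _ _))//.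
rewrite (le_trans _ tQ)// /Q mulrDr lerD//.
  rewrite (le_trans (normr_contact_form _ _))//.
  rewrite (_ : t * _ = (1 + 4 * n%:R * `|q|) * (2 * t)); last by ring.
  by rewrite ler_wpM2l ?addr_ge0 ?mulr_ge0// distrC.
rewrite (le_trans (normr_symp (a := t) (b := `|p - q| + 2) _ _))//.
- by rewrite (le_trans (normr_hproj _))// distrC.
- by rewrite (le_trans (normr_hproj _)).
- by rewrite le_eqVlt; apply/orP; left; apply/eqP; ring.
Qed.

(** The twisted vertical difference is linear in [p - q] because the symplectic form vanishes on the
    pair (q, q). *)
Lemma koranyiE p q : koranyi p q =
  (eucl_norm (hproj (p - q)) ^+ 4 + `|contact_form q (p - q)| ^+ 2) `^ 4^-1.
Proof.
rewrite /koranyi hprojB; congr ((_ + `|_| ^+ 2) `^ _).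
have tcB : tc (p - q) = tc p - tc q by rewrite /tc !mxE.
rewrite contact_formE tcB; congr (_ + 2 * _).
by apply: eq_bigr => j _; rewrite /xc /yc !mxE; ring.
Qed.

Lemma koranyi_ge0 p q : 0 <= koranyi p q. Proof. exact: powR_ge0. Qed.

Lemma koranyi4 p q : koranyi p q ^+ 4 =
  eucl_norm (hproj (p - q)) ^+ 4 + `|contact_form q (p - q)| ^+ 2.
Proof.
rewrite -powR_mulrn ?powR_ge0// koranyiE -powRrM mulVf ?powRr1//.
by rewrite addr_ge0 ?exprn_ge0 ?sqrtr_ge0.
Qed.

Lemma normr_hproj_koranyi p q : `|hproj (p - q)| <= koranyi p q.
Proof.
rewrite (le_trans (eucl_norm_ge _))//.
rewrite -(ler_pXn2r (n := 4)) ?nnegrE ?sqrtr_ge0 ?koranyi_ge0//.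
by rewrite koranyi4 lerDl exprn_ge0.
Qed.

Lemma contact_form_koranyi p q : `|contact_form q (p - q)| <= koranyi p q ^+ 2.
Proof.
rewrite -(ler_pXn2r (n := 2)) ?nnegrE ?exprn_ge0 ?koranyi_ge0//.
by rewrite -exprM koranyi4 lerDr exprn_ge0 ?sqrtr_ge0.
Qed.

(** The added 1 makes the constant D at least 1, so D <= D^4 and no fourth root has to be taken. *)
Lemma koranyi_le p q (A B c : R) : 0 <= A -> 0 <= B -> 0 <= c ->
  `|hproj (p - q)| <= A * c -> `|contact_form q (p - q)| <= B * c ^+ 2 ->
  koranyi p q <= (((n.*2)%:R * A) ^+ 4 + B ^+ 2 + 1) * c.
Proof.
move=> A0 B0 c0 hA hB; set D := _ + 1.
have D1 : 1 <= D by rewrite lerDr addr_ge0 ?exprn_ge0 ?mulr_ge0.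
rewrite -(ler_pXn2r (n := 4)) ?nnegrE ?koranyi_ge0 ?mulr_ge0//; last first.
  exact: le_trans D1.
rewrite koranyi4 exprMn.
apply: (@le_trans _ _ (D * c ^+ 4)); last first.
  by rewrite ler_wpM2r ?exprn_ge0// ler_eXnr.
rewrite /D !mulrDl mul1r -addrA lerD//.
  rewrite -exprMn ler_pXn2r ?nnegrE ?sqrtr_ge0 ?mulr_ge0//.
  by rewrite (le_trans (eucl_norm_le _))// -mulrA ler_wpM2l.
rewrite ler_wpDr ?exprn_ge0//.
have -> : c ^+ 4 = (c ^+ 2) ^+ 2 by rewrite -exprM.
by rewrite -exprMn ler_pXn2r ?nnegrE ?mulr_ge0 ?exprn_ge0.
Qed.

End heisenberg_algebra.

(** * Hölder conditions restated in the sup norm *)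

Section holder_sup_norm.
Context {R : realType} {m n : nat}.
Variables (K : set 'rV[R]_m) (f : 'rV[R]_m -> 'rV[R]_(n.*2.+1)) (g : R).
Hypothesis g0 : 0 < g.

Lemma eucl_dist_powR (x y : 'rV[R]_m) :
  `|x - y| `^ g <= eucl_dist x y `^ g <= m%:R `^ g * `|x - y| `^ g.
Proof.
apply/andP; split.
  by rewrite ge0_ler_powR ?nnegrE ?sqrtr_ge0 ?eucl_norm_ge// ltW.
rewrite -powRM//; apply: ge0_ler_powR.
- exact: ltW.
- exact: sqrtr_ge0.
- by rewrite nnegrE mulr_ge0.
- exact: eucl_norm_le.
Qed.

Lemma holder_sup (Y : Type) (d : Y -> Y -> R) (F : 'rV[R]_m -> Y) :
  (exists C : R, forall x y, K x -> K y ->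
     d (F x) (F y) <= C * eucl_dist x y `^ g) <->
  (exists2 C : R, 0 <= C & forall x y, K x -> K y ->
     d (F x) (F y) <= C * `|x - y| `^ g).
Proof.
split=> [[C HC]|[C C0 HC]].
  (* [C] comes without a sign; the factor m^g pays for the change of norm. *)
  exists (`|C| * m%:R `^ g) => [|x y Kx Ky]; first by rewrite mulr_ge0 ?powR_ge0.
  rewrite (le_trans (HC _ _ Kx Ky))// -mulrA.
  rewrite (@le_trans _ _ (`|C| * eucl_dist x y `^ g))//.
    by rewrite ler_wpM2r ?powR_ge0// ler_norm.
  by rewrite ler_wpM2l//; case/andP : (eucl_dist_powR x y).
exists C => x y Kx Ky; rewrite (le_trans (HC _ _ Kx Ky))//.
by rewrite ler_wpM2l//; case/andP : (eucl_dist_powR x y).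
Qed.

Lemma holder_hprojP :
  (exists C : R, forall x y, K x -> K y ->
     eucl_dist ((@hproj R n \o f) x) ((@hproj R n \o f) y)
       <= C * eucl_dist x y `^ g) <->
  (exists2 C : R, 0 <= C & forall x y, K x -> K y ->
     `|hproj (f x - f y)| <= C * `|x - y| `^ g).
Proof.
rewrite (@holder_sup _ (@eucl_dist R n.*2)).
split=> -[C C0 HC].
  exists C => // x y Kx Ky; rewrite hprojB (le_trans _ (HC _ _ Kx Ky))//.
  exact: eucl_norm_ge.
exists ((n.*2)%:R * C) => [|x y Kx Ky]; first by rewrite mulr_ge0.
rewrite (le_trans (eucl_norm_le _))// -mulrA ler_wpM2l//= -hprojB.
exact: HC.
Qed.

Lemma holder_koranyiP :
  (exists C : R, forall x y, K x -> K y ->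
     koranyi (f x) (f y) <= C * eucl_dist x y `^ g) <->
  (exists2 C : R, 0 <= C & forall x y, K x -> K y ->
     `|hproj (f x - f y)| <= C * `|x - y| `^ g /\
     `|contact_form (f y) (f x - f y)| <= C * (`|x - y| `^ g) ^+ 2).
Proof.
rewrite (@holder_sup _ (@koranyi R n)).
split=> -[C C0 HC].
  (* [C] serves the projection and [C ^+ 2] the contact form, which is bounded by the squared
     distance. *)
  exists (C + C ^+ 2) => [|x y Kx Ky]; first by rewrite addr_ge0 ?sqr_ge0.
  have Kxy := HC _ _ Kx Ky.
  have p0 := powR_ge0 `|x - y| g.
  rewrite (le_trans (normr_hproj_koranyi _ _)); last first.
    by rewrite (le_trans Kxy)// mulrDl lerDl mulr_ge0 ?sqr_ge0.
  split=> //; rewrite (le_trans (contact_form_koranyi _ _))//.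
  rewrite (@le_trans _ _ ((C * `|x - y| `^ g) ^+ 2))//.
    by rewrite ler_pXn2r ?nnegrE ?koranyi_ge0// mulr_ge0.
  by rewrite exprMn mulrDl lerDr mulr_ge0 ?sqr_ge0.
exists ((((n.*2)%:R * C) ^+ 4 + C ^+ 2 + 1)) => [|x y Kx Ky].
  by rewrite !addr_ge0 ?exprn_ge0 ?mulr_ge0.
have [h1 h2] := HC _ _ Kx Ky.
by apply: koranyi_le => //; exact: powR_ge0.
Qed.

End holder_sup_norm.

(** * Uniform convergence and compact neighbourhoods *)

Section topology_rV.
Context {R : realType} {m : nat}.

Lemma uniform_cvg0P (k : nat) (K : set 'rV[R]_m) (F : R -> 'rV[R]_m -> 'rV[R]_k) :
  {uniform K, F @ 0^'+ --> (fun _ : 'rV[R]_m => 0 : 'rV[R]_k)} <->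
  (forall d : R, 0 < d -> exists2 r : R, 0 < r &
     forall e x, 0 < e -> e < r -> K x -> `|F e x| <= d).
Proof.
split=> [cF d d0|HF P /uniform_nbhs[E [entE EP]]].
  have /cF : nbhs ((fun=> 0) : {uniform` K -> 'rV[R]_k})
      [set h : 'rV[R]_m -> 'rV[R]_k | forall y, K y -> ball 0 d (h y)].
    apply/uniform_nbhs; exists [set xy | ball xy.1 d xy.2]; split=> //.
    exact: entourage_ball (PosNum d0).
  move=> /nbhs_ballP[r /= r0 Hr]; exists r => // e x e0 er Kx.
  have /Hr /(_ e0 x Kx) : ball (0 : R) r e.
    by rewrite /ball/= sub0r normrN gtr0_norm.
  by rewrite -ball_normE/= sub0r normrN => /ltW.
move: entE; rewrite -entourage_ballE => -[d /= d0 dE].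
(* Halving turns the weak inequality of the hypothesis into the strict one of the ball. *)
have d20 : 0 < d / 2 by rewrite divr_gt0.
have [r r0 Hr] := HF _ d20.
apply/nbhs_ballP; exists r => //= e; rewrite /ball/= sub0r normrN => er e0.
apply: EP => y Ky; apply: dE => /=; rewrite -ball_normE/= sub0r normrN.
rewrite (le_lt_trans (Hr e y e0 _ Ky))//; last first.
  by rewrite ltr_pdivrMr// ltr_pMr// ltr1n.
by rewrite (le_lt_trans _ er)// ler_norm.
Qed.

(** Near-covering compactness: a radius that works near each point of [K] yields one for all of
    [K]. *)
Lemma compact_cball_sub (K Omega : set 'rV[R]_m) : compact K -> open Omega ->
  K `<=` Omega -> exists2 r : R, 0 < r & forall x, K x -> cball_sub Omega x r.
Proof.
move=> /compact_near_coveringP cK oO KO.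
have loc x : K x -> \forall x' \near x & r \near (0 : R)^'+, cball_sub Omega x' r.
  move=> Kx; have /nbhs_ballP[d /= d0 dO] : nbhs x Omega.
    by apply: open_nbhs_nbhs; split=> //; exact: KO.
  have d20 : 0 < d / 2 by rewrite divr_gt0.
  exists (ball x (d / 2), [set r | r < d / 2]) => /=.
    split; first exact: nbhsx_ballx.
    exact: nbhs_right_lt.
  move=> [x' r] /= [xx' rd] y x'y; apply: dO.
  move: xx'; rewrite -!ball_normE/= => xx'.
  rewrite (le_lt_trans (ler_distD x' _ _))// [ltRHS]splitr ltrD//.
  exact: le_lt_trans rd.
have := cK _ _ _ (at_right_proper_filter 0) loc.
move=> /nbhs_ballP[r /= r0 Hr]; exists (r / 2); first by rewrite divr_gt0.
apply: Hr => /=; last by rewrite divr_gt0.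
by rewrite /ball/= sub0r normrN gtr0_norm ?divr_gt0// ltr_pdivrMr// ltr_pMr// ltr1n.
Qed.

(** The values of [f] seen by mollification at points of [K], for scales up to [r], lie over this
    set; the closed inequality keeps it compact. *)
Definition thicken (K : set 'rV[R]_m) (r : R) : set 'rV[R]_m :=
  [set y | exists2 x, K x & `|x - y| <= r].

Lemma compact_thicken (K : set 'rV[R]_m) (r : R) : 0 <= r -> compact K ->
  compact (thicken K r).
Proof.
move=> r0 cK.
rewrite (_ : thicken K r = (fun xb : 'rV[R]_m * 'rV[R]_m => xb.1 - xb.2) @`
    (K `*` [set b | `|b| <= r])).
  apply: continuous_compact; last first.
    by apply: compact_setX => //; exact: compact_cball.
  apply: continuous_subspaceT => ab; apply: (@continuousB R 'rV[R]_m).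
    exact: cvg_fst.
  exact: cvg_snd.
apply/seteqP; split=> [y [x Kx xy]|_ [[x b] [/= Kx br] <-]].
  by exists (x, x - y) => //=; rewrite opprB addrC subrK.
by exists x => //; rewrite opprB addrC subrK.
Qed.

Lemma continuous_within_open (k : nat) (Omega : set 'rV[R]_m)
    (f : 'rV[R]_m -> 'rV[R]_k) : open Omega -> {within Omega, continuous f} ->
  forall y, Omega y -> {for y, continuous f}.
Proof.
move=> oO; rewrite continuous_open_subspace// => cf y Oy.
by apply: cf; exact/mem_set.
Qed.

End topology_rV.

(** * A dyadic sewing estimate for almost additive interval functions *)

Section sewing.
Context {R : realType}.
Variables (g : R) (phi : R -> R -> R) (A B D : R).
Hypotheses (g_gt : 2^-1 < g) (A0 : 0 <= A) (B0 : 0 <= B).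
Hypothesis phi_almost_additive : forall s u t,
  0 <= s -> s <= u -> u <= t -> t <= 1 ->
  `|phi s t - phi s u - phi u t| <= A * ((t - s) `^ g) ^+ 2.
Hypothesis phi_small : forall s t, 0 <= s -> s <= t -> t <= 1 ->
  `|phi s t| <= (t - s) * (D + B * (t - s) `^ g).

Let h : R := 2^-1 `^ g.

(** The sum of the geometric series of ratio [2 * h ^+ 2]: a halving doubles the number of intervals
    and multiplies each error by [h ^+ 2]. *)
Definition sewing_constant : R := (1 - 2 * (2^-1 `^ g) ^+ 2)^-1.

(** This is where [2^-1 < g] enters the sewing argument: the ratio is 1/2 to the positive power 2g -
    1. *)
Lemma sewing_ratio_lt1 : 2 * h ^+ 2 < 1.
Proof.
rewrite -powR_mulrn ?powR_ge0// -powRrM.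
have -> : g * 2 = 1 + (g * 2 - 1) by ring.
rewrite powRD ?powRr1//; last by rewrite invr_eq0 pnatr_eq0 implybT.
rewrite mulrA divff// mul1r.
have c0 : 0 < g * 2 - 1 by rewrite subr_gt0 -ltr_pdivrMr// div1r.
have := @gt0_ltr_powR R _ c0 2^-1 1.
by rewrite powR1 !nnegrE; apply => //; rewrite invf_lt1// ltr1n.
Qed.

Lemma sewing_constantE : 1 + 2 * h ^+ 2 * sewing_constant = sewing_constant.
Proof.
have r1 := sewing_ratio_lt1; rewrite /sewing_constant -/h.
by field; rewrite gt_eqF// subr_gt0.
Qed.

Lemma sewing_constant_ge0 : 0 <= sewing_constant.
Proof. by rewrite invr_ge0 subr_ge0 ltW// sewing_ratio_lt1. Qed.

(* Each halving of the interval costs a geometrically decreasing error. *)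
Lemma sewing_step N s t : 0 <= s -> s <= t -> t <= 1 ->
  `|phi s t| <= A * sewing_constant * ((t - s) `^ g) ^+ 2 +
                (t - s) * (D + B * ((t - s) `^ g * h ^+ N)).
Proof.
elim: N s t => [|N IH] s t s0 st t1.
  rewrite expr0 mulr1 (le_trans (phi_small s0 st t1))// lerDr.
  by rewrite !mulr_ge0 ?sewing_constant_ge0 ?powR_ge0.
pose u := (s + t) / 2.
have su : s <= u by rewrite /u; lra.
have ut : u <= t by rewrite /u; lra.
have us : u - s = (t - s) * 2^-1 by rewrite /u; field.
have tu : t - u = (t - s) * 2^-1 by rewrite /u; field.
have pE : ((t - s) * 2^-1) `^ g = (t - s) `^ g * h.
  by rewrite powRM// subr_ge0.
have := IH _ _ s0 su (le_trans ut t1); rewrite us pE.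
have := IH _ _ (le_trans s0 su) ut t1; rewrite tu pE.
have := phi_almost_additive s0 su ut t1 => HX HZ HY.
have tri : `|phi s t| <= `|phi s t - phi s u - phi u t| + `|phi s u| + `|phi u t|.
  rewrite {1}(_ : phi s t = (phi s t - phi s u - phi u t) + phi s u + phi u t).
    by rewrite (le_trans (ler_normD _ _))// lerD2r ler_normD.
  by ring.
rewrite (le_trans tri)// (le_trans (lerD (lerD HX HY) HZ))//.
rewrite [h ^+ N.+1]exprS.
(* The two halves contribute [2 * h ^+ 2] times the old sewing term, their lengths add up to
   [t - s], and the [B] term gains one factor [h]; [sewing_constantE] absorbs the new defect. *)
rewrite [leLHS](_ : _ =
    A * (1 + 2 * h ^+ 2 * sewing_constant) * ((t - s) `^ g) ^+ 2 +
    (t - s) * (D + B * ((t - s) `^ g * (h * h ^+ N)))); last by field.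
by rewrite sewing_constantE.
Qed.

(** Letting [N] grow removes [B]. This is essential, since the [B] used later carries a factor
    e^(g-1), unbounded as e tends to 0 when g < 1. *)
Lemma sewing : `|phi 0 1| <= A * sewing_constant + D.
Proof.
have h0 : 0 <= h by exact: powR_ge0.
have h1 : `|h| < 1.
  rewrite ger0_norm//; have := sewing_ratio_lt1; nra.
apply/ler_addgt0Pr => d d0.
have d' : 0 < d / (B + 1) by rewrite divr_gt0// ltr_wpDl.
have : h ^+ N @[N --> \oo] --> 0 by exact: cvg_expr.
move=> /cvgrPdist_le /(_ _ d')[N _ /(_ N (leqnn N))] /=.
rewrite sub0r normrN ger0_norm ?exprn_ge0// => hN.
have := sewing_step N (lexx 0) ler01 (lexx 1).
rewrite subr0 powR1 expr1n !mul1r mulr1 addrA => /le_trans; apply.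
rewrite lerD2l (le_trans (ler_wpM2l B0 hN))//.
by rewrite mulrA ler_pdivrMr ?ltr_wpDl// mulrC ler_wpM2l ?lerDl// ltW.
Qed.

End sewing.

(** * Mollification of maps into the Heisenberg group *)

Section mollified_heisenberg.
Context {R : realType} {m n : nat}.
Variable eta : 'rV[R]_m -> R.
Hypothesis eta_mollifier : mollifier eta.
Variables (Omega : set 'rV[R]_m) (f : 'rV[R]_m -> 'rV[R]_(n.*2.+1)).
Hypothesis cf : forall y, Omega y -> {for y, continuous f}.
Local Notation "''d_' i" := (fun x => 'D_(delta_mx 0 i : 'rV[R]_m) eta x)
  (at level 8, i at level 2).
Local Notation fe := (mollify eta Omega f).
Local Notation V := (@cube_volume R m 1).

(** The [j]-th partial derivative of the mollification, with the derivative placed on [eta]; see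
    [mollify_diffE]. *)
Definition mollify_partial (e : R) (x : 'rV[R]_m) (j : 'I_m) : 'rV[R]_(n.*2.+1) :=
  e^-1 *: smearv f x e 'd_j.

Lemma eta_bound : exists2 M : R, 0 <= M & (forall w, `|eta w| <= M) /\
  forall j w, `|'d_j w| <= M.
Proof.
have [M M0 HM] := cc_bounded ler01 (eta_cc eta_mollifier).
have /choice[N HN] : forall j, exists N : R, 0 <= N /\ forall w, `|'d_j w| <= N.
  move=> j; have [N ? ?] := cc_bounded ler01 (partial_eta_cc eta_mollifier j).
  by exists N.
have S0 : 0 <= \sum_j N j by apply: sumr_ge0 => j _; case: (HN j).
exists (M + \sum_j N j); first by rewrite addr_ge0.
split=> [w|j w]; first by rewrite (le_trans (HM w))// lerDl.
have [_ /(_ w) /le_trans] := HN j; apply.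
rewrite (bigD1 j)//= addrCA lerDl addr_ge0//.
by apply: sumr_ge0 => i _; case: (HN i).
Qed.

Lemma mollify_differentiable e x : 0 < e -> cball_sub Omega x (2 * e) ->
  differentiable (fe e) x.
Proof. by move=> e0 xO; have [] := mollify_diff eta_mollifier cf e0 xO. Qed.

Lemma mollify_diffE e x v : 0 < e -> cball_sub Omega x (2 * e) ->
  'd (fe e) x v = \sum_j v 0 j *: mollify_partial e x j.
Proof. by move=> e0 xO; have [_ ->] := mollify_diff eta_mollifier cf e0 xO. Qed.

Lemma form_coefE e x j : 0 < e -> cball_sub Omega x (2 * e) ->
  form_coef (pullback (fe e) (@contact_form R n)) x 0 j =
  contact_form (fe e x) (mollify_partial e x j).
Proof.
move=> e0 xO; rewrite mxE /pullback mollify_diffE//; congr contact_form.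
rewrite (bigD1 j)//= big1 ?addr0 => [|i ij].
  by rewrite mxE !eqxx scale1r.
by rewrite mxE (negbTE ij) andbF scale0r.
Qed.

Lemma mollify_pointwise_cvg a d : Omega a -> open Omega -> 0 < d ->
  exists2 r : R, 0 < r & forall e, 0 < e -> e < r -> `|fe e a - f a| <= d.
Proof.
move=> Oa oO d0.
have [M M0 [HM _]] := eta_bound.
have V0 : 0 <= V by exact: cube_volume_ge0.
have MV1 : 0 < M * V + 1 by rewrite ltr_wpDl// mulr_ge0.
(* [smearv_near] multiplies the oscillation of [f] by [M * V]; the 1 keeps the divisor positive. *)
have c0 : 0 < d / (M * V + 1) by rewrite divr_gt0.
have /(@compact_cball_sub R m [set a] Omega)/(_ oO) := @compact_set1 _ a.
move=> /(_ _)[|r1 r10 r1P]; first by move=> _ ->.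
have /cvgrPdist_le/(_ _ c0) := cf Oa.
move=> /nbhs_ballP[r2 /= r20 Hr2].
exists (Num.min (r1 / 2) r2); first by rewrite lt_min divr_gt0.
move=> e e0; rewrite lt_min => /andP[er1 er2].
have aO2 : cball_sub Omega a (2 * e).
  move=> y ay; apply: (r1P a) => //; rewrite (le_trans ay)// mulrC.
  by rewrite -ler_pdivlMr// ltW.
have aO : cball_sub Omega a e.
  by move=> y ay; apply: aO2; rewrite (le_trans ay)// ler_peMl ?ltW// ltr1n.
rewrite mollifyE//; apply/normr_rV_leP => [|i]; first exact: ltW.
have := @smearv_near R m _ Omega f cf (fun v => v 0 i) a e eta M
  (d / (M * V + 1)) (f a 0 i) e0 aO (eta_cc eta_mollifier) HM
  (@linform_coord R _ i).
rewrite eta_integral// mulr1 => near_a.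
rewrite mxE [X in _ + X]mxE (le_trans (near_a _))//.
  move=> y ay; have := Hr2 y; rewrite -ball_normE/= => /(_ (le_lt_trans ay er2)).
  move=> /(le_trans _) -> //; rewrite distrC.
  by have := normr_rV_ge (f a - f y) i; rewrite !mxE.
rewrite -mulrA -mulrA [_^-1 * _]mulrC mulrA ler_pdivrMr// ler_wpM2l ?ltW//.
by rewrite ltrDl.
Qed.

(** * Quantitative estimates at scales up to [r] *)

Section estimates.
Variables (K : set 'rV[R]_m) (r C M g : R).
Hypotheses (g0 : 0 < g) (C0 : 0 <= C) (M0 : 0 <= M).
Hypothesis eta_le : forall w, `|eta w| <= M.
Hypothesis partial_eta_le : forall j w, `|'d_j w| <= M.
Hypothesis KO : forall x, K x -> cball_sub Omega x (2 * r).
Hypothesis f_holder : forall x y, thicken K r x -> thicken K r y ->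
  `|hproj (f x - f y)| <= C * `|x - y| `^ g.

Let V0 : 0 <= V. Proof. exact: cube_volume_ge0. Qed.

Let KO2 e x : 0 < e -> e <= r -> K x -> cball_sub Omega x (2 * e).
Proof.
move=> e0 er Kx y xy; apply: (KO Kx); rewrite (le_trans xy)//.
by rewrite ler_wpM2l.
Qed.

Let KO1 e x : 0 < e -> e <= r -> K x -> cball_sub Omega x e.
Proof.
move=> e0 er Kx y xy; apply: (KO2 e0 er Kx); rewrite (le_trans xy)//.
by rewrite ler_peMl ?ltW// ltr1n.
Qed.

Let thickK e x y : e <= r -> K x -> `|x - y| <= e -> thicken K r y.
Proof. by move=> er Kx xy; exists x => //; exact: le_trans er. Qed.

Let thickKK e x : 0 < e -> e <= r -> K x -> thicken K r x.
Proof. by move=> e0 er Kx; apply: (thickK er Kx); rewrite subrr normr0 ltW. Qed.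

Let hproj_coordE (v : 'rV[R]_(n.*2.+1)) i :
  hproj v 0 i = v 0 (widen_ord (leqnSn n.*2) i).
Proof. by rewrite mxE. Qed.

Let f_coord_near e x y i : 0 < e -> e <= r -> K x -> `|x - y| <= e ->
  `|f y 0 (widen_ord (leqnSn n.*2) i) - f x 0 (widen_ord (leqnSn n.*2) i)|
    <= C * e `^ g.
Proof.
move=> e0 er Kx xy.
have := normr_rV_ge (hproj (f y - f x)) i; rewrite !mxE => /le_trans; apply.
rewrite (le_trans (f_holder (thickK er Kx xy) (thickKK e0 er Kx)))//.
by rewrite ler_wpM2l// ge0_ler_powR ?nnegrE ?(ltW g0) ?(ltW e0)// distrC.
Qed.

Lemma hproj_mollify_near e x : 0 < e -> e <= r -> K x ->
  `|hproj (fe e x - f x)| <= C * e `^ g * M * V.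
Proof.
move=> e0 er Kx; apply/normr_rV_leP => [|i].
  by rewrite !mulr_ge0 ?powR_ge0.
rewrite hproj_coordE mxE [X in _ + X]mxE mollifyE//; last exact: KO2.
set i' := widen_ord _ _.
have := @smearv_near R m _ Omega f cf (fun v => v 0 i') x e eta M
  (C * e `^ g) (f x 0 i') e0 (KO1 e0 er Kx) (eta_cc eta_mollifier) eta_le
  (@linform_coord R _ i').
rewrite eta_integral// mulr1; apply=> y xy.
exact: (@f_coord_near e).
Qed.

(** Since the integral of the partial of [eta] vanishes, the constant [l (f x)] may be subtracted,
    leaving only the oscillation over the ball of radius [e]. *)
Lemma linform_mollify_partial (l : 'rV[R]_(n.*2.+1) -> R) e x j B :
  linform l -> 0 < e -> e <= r -> K x ->
  (forall y, `|x - y| <= e -> `|l (f y) - l (f x)| <= B) ->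
  `|l (mollify_partial e x j)| <= e^-1 * (B * M * V).
Proof.
move=> ll e0 er Kx lB.
have := @smearv_near R m _ Omega f cf l x e 'd_j M B (l (f x)) e0 (KO1 e0 er Kx)
  (partial_eta_cc eta_mollifier j) (partial_eta_le j) ll lB.
rewrite partial_eta_integral// mulr0 subr0 => lj.
by rewrite linformZ// normrM gtr0_norm ?invr_gt0// ler_wpM2l// invr_ge0 ltW.
Qed.

Lemma hproj_mollify_partial e x j : 0 < e -> e <= r -> K x ->
  `|hproj (mollify_partial e x j)| <= e^-1 * (C * e `^ g * M * V).
Proof.
move=> e0 er Kx; apply/normr_rV_leP => [|i].
  by rewrite !mulr_ge0 ?powR_ge0// invr_ge0 ltW.
rewrite hproj_coordE.
apply: (@linform_mollify_partial (fun v => v 0 (widen_ord (leqnSn n.*2) i))) => //.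
  exact: linform_coord.
by move=> y xy; exact: f_coord_near.
Qed.

Lemma hproj_mollify_holder e x y : 0 < e -> e <= r -> K x -> K y ->
  `|hproj (fe e x - fe e y)| <= C * M * V * `|x - y| `^ g.
Proof.
move=> e0 er Kx Ky; apply/normr_rV_leP => [|i].
  by rewrite !mulr_ge0 ?powR_ge0.
rewrite hproj_coordE mxE [X in _ + X]mxE !mollifyE//; try exact: KO2.
set i' := widen_ord _ _.
have := @smearv_diff R m _ Omega f cf (fun v => v 0 i') x y e eta M
  (C * `|x - y| `^ g) e0 _ (KO1 e0 er Kx) (KO1 e0 er Ky) (eta_cc eta_mollifier)
  eta_le (@linform_coord R _ i').
rewrite (_ : C * _ * M * V = C * M * V * `|x - y| `^ g); last by ring.
apply=> [|w we]; first by rewrite mulr_ge0 ?powR_ge0.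
have xyw : x - w - (y - w) = x - y by rewrite opprB addrA subrK.
have inK z : K z -> thicken K r (z - w).
  by move=> Kz; apply: (thickK er Kz); rewrite opprB addrC subrK.
have := f_holder (inK _ Kx) (inK _ Ky); rewrite xyw; apply: le_trans.
by have := normr_rV_ge (hproj (f (x - w) - f (y - w))) i; rewrite !mxE.
Qed.

Lemma form_coef_le e x j : 0 < e -> e <= r -> K x ->
  (forall y, `|x - y| <= e ->
     `|contact_form (f x) (f y - f x)| <= C * (e `^ g) ^+ 2) ->
  `|form_coef (pullback (fe e) (@contact_form R n)) x 0 j| <=
  (C * M * V + 4 * n%:R * (C * M * V) ^+ 2) * (e^-1 * (e `^ g) ^+ 2).
Proof.
move=> e0 er Kx fC.
rewrite form_coefE//; last exact: KO2.
(* With base point [f x] the form is a fixed linear form and commutes with the integral; the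
   correction is symplectic, with factors of order e^g and e^(g-1). *)
rewrite (contact_formBl _ (f x)) (le_trans (ler_normD _ _))//.
rewrite [leRHS]mulrDl lerD//.
  have lB y : `|x - y| <= e ->
      `|contact_form (f x) (f y) - contact_form (f x) (f x)|
        <= C * (e `^ g) ^+ 2.
    by move=> xy; rewrite -(linformB _ _ (contact_linform _)); exact: fC.
  rewrite (le_trans (linform_mollify_partial j (contact_linform _) e0 er Kx lB))//.
  by rewrite le_eqVlt; apply/orP; left; apply/eqP; ring.
have h1 := hproj_mollify_near e0 er Kx.
have h2 := hproj_mollify_partial j e0 er Kx.
rewrite (le_trans (normr_symp h1 h2))//.
by rewrite le_eqVlt; apply/orP; left; apply/eqP; ring.
Qed.

(** [sewing] along the segment from [a] to [b]. The dependence on [e] enters only through [d], so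
    the bound survives the limit. *)
Lemma contact_mollify_le e a b d : 2^-1 < g -> 0 < e -> e <= r ->
  (forall s : R, 0 <= s -> s <= 1 -> K (a + s *: (b - a))) ->
  (forall x j, K x ->
     `|form_coef (pullback (fe e) (@contact_form R n)) x 0 j| <= d) ->
  `|contact_form (fe e a) (fe e b - fe e a)| <=
  4 * n%:R * (C * M * V) ^+ 2 * sewing_constant g * (`|b - a| `^ g) ^+ 2 +
  m%:R * `|b - a| * d.
Proof.
move=> g_gt e0 er segK coef_d.
pose x s := a + s *: (b - a); pose q s := fe e (x s).
pose L := `|b - a|; pose A1 := C * M * V * L `^ g.
pose E := e^-1 * (C * e `^ g * M * V).
have A10 : 0 <= A1 by rewrite !mulr_ge0 ?powR_ge0.
have n40 : 0 <= 4 * n%:R :> R by rewrite mulr_ge0.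
have mL0 : 0 <= m%:R * L by exact: mulr_ge0 (ler0n _ _) (normr_ge0 _).
have E0 : 0 <= E by rewrite !mulr_ge0 ?powR_ge0// invr_ge0 ltW.
have q_holder s t : 0 <= s -> s <= t -> t <= 1 ->
    `|hproj (q s - q t)| <= A1 * (t - s) `^ g.
  move=> s0 st t1.
  have Ks : K (x s) by apply: segK => //; exact: le_trans t1.
  have Kt : K (x t) by apply: segK => //; exact: le_trans st.
  have -> : A1 * (t - s) `^ g = C * M * V * `|x s - x t| `^ g.
    have -> : x s - x t = (s - t) *: (b - a).
      by rewrite /x scalerBl opprD addrACA subrr add0r.
    rewrite normrZ distrC ger0_norm ?subr_ge0// powRM ?subr_ge0//.
    by rewrite /A1 /L; ring.
  exact: hproj_mollify_holder.
pose phi s t := contact_form (q s) (q t - q s).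
have x0 : x 0 = a by rewrite /x scale0r addr0.
have x1 : x 1 = b by rewrite /x scale1r addrC subrK.
have -> : contact_form (fe e a) (fe e b - fe e a) = phi 0 1.
  by rewrite /phi /q x0 x1.
have -> : 4 * n%:R * (C * M * V) ^+ 2 * sewing_constant g * (L `^ g) ^+ 2 +
    m%:R * L * d = 4 * n%:R * A1 ^+ 2 * sewing_constant g + m%:R * L * d.
  by rewrite /A1; ring.
(* [A] is the additivity defect from the Hölder bound [A1], [B] the cost of moving the base point in
   the mean value step, and [D], left to unification, the contribution of the coefficients. *)
apply: (@sewing R g phi (4 * n%:R * A1 ^+ 2) (4 * n%:R * A1 * (m%:R * L * E))).
- by [].
- by rewrite mulr_ge0 ?sqr_ge0.
- exact: mulr_ge0 (mulr_ge0 n40 A10) (mulr_ge0 mL0 E0).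
- move=> s u t s0 su ut t1.
  (* By linearity the first two terms give the form at [q s] on [q t - q u]; passing to base point
     [q u] leaves the symplectic term. *)
  have -> : phi s t - phi s u - phi u t = 2 * symp (q s - q u) (q t - q u).
    rewrite /phi -(linformB _ _ (contact_linform _)) opprB addrA subrK.
    by rewrite (contact_formBl (q s) (q u)); ring.
  have st : s <= t by exact: le_trans ut.
  have mono v w : 0 <= v -> v <= w -> v `^ g <= w `^ g.
    by move=> v0 vw; rewrite ge0_ler_powR ?nnegrE ?(ltW g0)// (le_trans v0).
  have h1 : `|hproj (q s - q u)| <= A1 * (t - s) `^ g.
    rewrite (le_trans (q_holder s u s0 su (le_trans ut t1)))// ler_wpM2l// mono//.
      by rewrite subr_ge0.
    by rewrite lerD2r.
  have h2 : `|hproj (q t - q u)| <= A1 * (t - s) `^ g.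
    rewrite (_ : hproj _ = - hproj (q u - q t)); last first.
      by rewrite !hprojB opprB.
    rewrite normrN (le_trans (q_holder u t (le_trans s0 su) ut t1))// ler_wpM2l//.
    by rewrite mono// ?subr_ge0// lerD2l lerN2.
  rewrite (le_trans (normr_symp h1 h2))//.
  by rewrite le_eqVlt; apply/orP; left; apply/eqP; ring.
- move=> s t s0 st t1.
  (* The base point is frozen at [q s] for the mean value theorem, then moved to [q v], where the
     pullback coefficients appear. *)
  pose Psi := @contact_form R n (q s) \o fe e.
  have Kv v : s <= v -> v <= t -> K (x v).
    by move=> sv vt; apply: segK; [exact: le_trans sv|exact: le_trans t1].
  have dPsi v : s <= v -> v <= t -> is_derive v (1 : R) (fun u => Psi (x u))
      (contact_form (q s) ('d (fe e) (x v) (b - a))).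
    move=> sv vt.
    have dfe := mollify_differentiable e0 (KO2 e0 er (Kv v sv vt)).
    have [dl <-] := linform_derive (b - a) (contact_linform (q s)) dfe.
    exact: is_derive_line.
  have [||v] := @MVT_segment R (fun u => Psi (x u))
      (fun v => contact_form (q s) ('d (fe e) (x v) (b - a))) s t st.
  + by move=> v; rewrite in_itv/= => /andP[/ltW sv /ltW vt]; exact: dPsi.
  + apply: derivable_within_continuous => v; rewrite in_itv/= => /andP[sv vt].
    by case: (dPsi v sv vt).
  rewrite in_itv/= => /andP[sv vt] mvt.
  have -> : phi s t = Psi (x t) - Psi (x s).
    by rewrite /phi /Psi /= (linformB _ _ (contact_linform _)).
  rewrite mvt normrM [`|t - s|]ger0_norm ?subr_ge0// mulrC ler_wpM2l ?subr_ge0//.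
  rewrite (mollify_diffE _ e0 (KO2 e0 er (Kv v sv vt))).
  set w := \sum_j _.
  rewrite (contact_formBl (q s) (q v)) (le_trans (ler_normD _ _))//.
  have ba j : `|(b - a) 0 j| <= L by exact: normr_rV_ge.
  apply: lerD.
    rewrite /w linform_sum; last exact: contact_linform.
    rewrite (le_trans (ler_norm_sum _ _ _))//.
    have t' j : `|(b - a) 0 j * contact_form (q v) (mollify_partial e (x v) j)| <=
        L * d.
      rewrite normrM ler_pM// -form_coefE//; first exact/coef_d/Kv.
      exact: (KO2 e0 er (Kv v sv vt)).
    rewrite (le_trans (ler_sum _ (fun j _ => t' j)))// sumr_const card_ord.
    by rewrite -mulrA mulr_natl.
  have hw : `|hproj w| <= m%:R * L * E.
    apply/normr_rV_leP => [|i]; first exact: mulr_ge0.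
    rewrite hproj_coordE /w (linform_sum _ _ _ (@linform_coord R _ _)).
    rewrite (le_trans (ler_norm_sum _ _ _))//.
    have t' j : `|(b - a) 0 j * mollify_partial e (x v) j 0
        (widen_ord (leqnSn n.*2) i)| <= L * E.
      rewrite normrM ler_pM// -hproj_coordE (le_trans (normr_rV_ge _ _))//.
      exact/hproj_mollify_partial/Kv.
    rewrite (le_trans (ler_sum _ (fun j _ => t' j)))// sumr_const card_ord.
    by rewrite -mulrA mulr_natl.
  have hs : `|hproj (q s - q v)| <= A1 * (t - s) `^ g.
    rewrite (le_trans (q_holder s v s0 sv (le_trans vt t1)))// ler_wpM2l//.
    by rewrite ge0_ler_powR ?nnegrE ?subr_ge0 ?(ltW g0)// lerD2r.
  rewrite (le_trans (normr_symp hs hw))//.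
  by rewrite le_eqVlt; apply/orP; left; apply/eqP; ring.
Qed.

End estimates.

End mollified_heisenberg.

(** * The characterisation of Hölder maps into the Heisenberg group *)

Theorem theorem7p1 (R : realType) (m n : nat)
  (eta : 'rV[R]_m -> R) (eta_mollifier : mollifier eta)
  (Omega : set 'rV[R]_m) (Omega_open : open Omega)
  (f : 'rV[R]_m -> 'rV[R]_(n.*2.+1)) (f_cont : {within Omega, continuous f})
  (gamma : R) (gamma_gt : 2^-1 < gamma) (gamma_le : gamma <= 1) :
  holder_loc (@koranyi R n) gamma Omega f <->
  (holder_loc (@eucl_dist R n.*2) gamma Omega (@hproj R n \o f) /\
   forall K : set 'rV[R]_m, compact K -> K `<=` Omega ->
     {uniform K,
       (fun eps : R => form_coef
          (pullback (mollify eta Omega f eps) (@contact_form R n))) @ 0^'+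
       --> (fun _ : 'rV[R]_m => 0 : 'rV[R]_m)}).
Proof.
have cf := continuous_within_open Omega_open f_cont.
have g0 : 0 < gamma by apply: lt_trans gamma_gt; rewrite invr_gt0.
have [M M0 [etaM detaM]] := eta_bound eta_mollifier.
pose V := @cube_volume R m 1.
have V0 : 0 <= V by exact: cube_volume_ge0.
have powR_mono (x y : R) : 0 <= x -> x <= y ->
    (x `^ gamma) ^+ 2 <= (y `^ gamma) ^+ 2.
  move=> x0 xy; rewrite ler_pXn2r ?nnegrE ?powR_ge0//.
  by rewrite ge0_ler_powR ?nnegrE ?(ltW g0)// (le_trans x0).
split=> [hol|[hola unif] K cK KO].
  have holP K cK KO := (holder_koranyiP K f g0).1 (hol K cK KO).
  split=> K cK KO.
    apply/(holder_hprojP K f g0); have [C C0 HC] := holP K cK KO.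
    by exists C => // x y Kx Ky; have [] := HC x y Kx Ky.
  apply/uniform_cvg0P => d d0.
  have [r0 r00 Kr0] := compact_cball_sub cK Omega_open KO.
  (* Balls of radius [2 * r] about [K] must stay in [Omega]. *)
  pose r := r0 / 2; have rp : 0 < r by rewrite divr_gt0.
  have KO2 x : K x -> cball_sub Omega x (2 * r).
    by move=> Kx; rewrite /r mulrC divfK//; exact: Kr0.
  have TO : thicken K r `<=` Omega.
    move=> y [x Kx xy]; apply: (KO2 x Kx); rewrite (le_trans xy)//.
    by rewrite ler_peMl ?ler1n// ltW.
  have [C C0 HC] := holP _ (compact_thicken (ltW rp) cK) TO.
  pose Q := C * M * V + 4 * n%:R * (C * M * V) ^+ 2.
  have Q0 : 0 <= Q by rewrite addr_ge0 ?mulr_ge0 ?sqr_ge0.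
  have Q1 : 0 < Q + 1 by rewrite ltr_wpDl.
  (* The exponent of [e] in [form_coef_le]; its positivity makes the bound tend to 0. *)
  have c0 : 0 < gamma * 2 - 1 by rewrite subr_gt0 -ltr_pdivrMr// div1r.
  have dQ : 0 < d / (Q + 1) by rewrite divr_gt0.
  have /cvgrPdist_le/(_ _ dQ) := powR_cvg0 c0.
  move=> /nbhs_ballP[r1 /= r10 Hr1].
  exists (Num.min r r1); first by rewrite lt_min rp.
  move=> e x e0; rewrite lt_min => /andP[/ltW er er1] Kx.
  apply/(normr_rV_leP _ (ltW d0)) => j.
  have inT y : `|x - y| <= e -> thicken K r y.
    by move=> xy; exists x => //; exact: le_trans er.
  have inTx : thicken K r x by apply: inT; rewrite subrr normr0 ltW.
  rewrite (le_trans (@form_coef_le R m n eta eta_mollifier Omega f cf K r C M gamma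
    g0 C0 M0 etaM detaM KO2 _ e x j e0 er Kx _))//.
  - by move=> y z Ty Tz; have [] := HC y z Ty Tz.
  - move=> y xy; have [_ /le_trans] := HC y x (inT y xy) inTx; apply.
    by rewrite ler_wpM2l// powR_mono// distrC.
  rewrite -/V -/Q (_ : e^-1 * _ = e `^ (gamma * 2 - 1)); last first.
    rewrite -powR_mulrn ?powR_ge0// -powRrM -powR_inv1 ?ltW// -powRD.
      by rewrite addrC.
    by apply/implyP => _; rewrite gt_eqF.
  have : ball (0 : R) r1 e by rewrite /ball/= sub0r normrN gtr0_norm.
  move=> /Hr1 /(_ e0); rewrite sub0r normrN ger0_norm ?powR_ge0// => he.
  rewrite (@le_trans _ _ (Q * (d / (Q + 1))))//; first by rewrite ler_wpM2l.
  by rewrite mulrA ler_pdivrMr// mulrC ler_wpM2l ?lerDl// ltW.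
apply/(holder_koranyiP K f g0).
have [r0 r00 Kr0] := compact_cball_sub cK Omega_open KO.
(* One [r] is spent on thickening [K] to [K1], two on the balls about points of [K1]. *)
pose r := r0 / 3; have rp : 0 < r by rewrite divr_gt0.
have r3 : r + 2 * r = r0 by rewrite /r; field.
pose K1 := thicken K r.
have cK1 : compact K1 by exact: compact_thicken (ltW rp) cK.
have K1O2 x : K1 x -> cball_sub Omega x (2 * r).
  move=> [k Kk kx] y xy; apply: (Kr0 k Kk).
  by rewrite (le_trans (ler_distD x _ _))// -r3 lerD.
have K1O1 x y : K1 x -> `|x - y| <= r -> Omega y.
  move=> K1x xy; apply: (K1O2 x K1x); rewrite (le_trans xy)//.
  by rewrite ler_peMl ?ler1n// ltW.
have thickS (A : set 'rV[R]_m) : A `<=` thicken A r.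
  by move=> x Ax; exists x => //; rewrite subrr normr0 ltW.
have K1O : K1 `<=` Omega.
  by move=> x K1x; apply: (K1O1 x) => //; rewrite subrr normr0 ltW.
have T1O : thicken K1 r `<=` Omega by move=> y [x K1x xy]; exact: K1O1 xy.
have [C C0 HC] := (holder_hprojP _ f g0).1
  (hola _ (compact_thicken (ltW rp) cK1) T1O).
pose C2 := 4 * n%:R * (C * M * V) ^+ 2 * sewing_constant gamma.
have C20 : 0 <= C2 by rewrite !mulr_ge0 ?sqr_ge0 ?sewing_constant_ge0.
(* [K] may fail to be convex, but for points at distance at most [r] the segment between them stays
   in [K1]. *)
have key a b : K a -> K b -> `|b - a| <= r ->
    `|contact_form (f a) (f b - f a)| <= C2 * (`|b - a| `^ gamma) ^+ 2.
  move=> Ka Kb abr; apply/ler_addgt0Pr => d d0.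
  (* One half of [d] pays for replacing [f] by its mollification at both ends, the other for the
     pullback coefficients, which sewing multiplies by [mL]. *)
  have d20 : 0 < d / 2 by rewrite divr_gt0.
  have [t t0 Ht] := contact_form_perturb (f b) (f a) d20.
  have [ra ra0 Hra] :=
    mollify_pointwise_cvg eta_mollifier cf (KO _ Ka) Omega_open t0.
  have [rb rb0 Hrb] :=
    mollify_pointwise_cvg eta_mollifier cf (KO _ Kb) Omega_open t0.
  pose mL := m%:R * `|b - a|.
  have mL0 : 0 <= mL by rewrite mulr_ge0.
  have mL1 : 0 < mL + 1 by rewrite ltr_wpDl.
  have dm0 : 0 < d / 2 / (mL + 1) by rewrite divr_gt0.
  have /uniform_cvg0P /(_ _ dm0)[rc rc0 Hrc] := unif K1 cK1 K1O.
  pose e := Num.min (Num.min r ra) (Num.min rb rc) / 2.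
  have min0 : 0 < Num.min (Num.min r ra) (Num.min rb rc).
    by rewrite !lt_min rp ra0 rb0.
  have e0 : 0 < e by rewrite divr_gt0.
  have : e < Num.min (Num.min r ra) (Num.min rb rc).
    by rewrite ltr_pdivrMr// ltr_pMr// ltr1n.
  rewrite !lt_min => /andP[/andP[er era] /andP[erb erc]].
  rewrite (le_trans (Ht _ _ (Hrb e e0 erb) (Hra e e0 era)))//.
  rewrite [X in _ <= _ + X]splitr addrA lerD2r.
  have segK1 s : 0 <= s -> s <= 1 -> K1 (a + s *: (b - a)).
    move=> s0 s1; exists a => //; rewrite opprD addrA subrr sub0r normrN normrZ.
    by rewrite ger0_norm// (le_trans _ abr)// ler_piMl.
  have coef_le x j : K1 x -> `|form_coef (pullback (mollify eta Omega f e)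
      (@contact_form R n)) x 0 j| <= d / 2 / (mL + 1).
    by move=> K1x; rewrite (le_trans (normr_rV_ge _ _))// Hrc.
  have := @contact_mollify_le R m n eta eta_mollifier Omega f cf K1 r C M gamma
    g0 C0 M0 etaM detaM K1O2 HC e a b _ gamma_gt e0 (ltW er) segK1 coef_le.
  move=> /le_trans; apply; rewrite lerD2l -/mL.
  by rewrite mulrA ler_pdivrMr// mulrC ler_wpM2l ?lerDl// ltW.
have cnf y : K y -> {for y, continuous (fun y => `|f y|)}.
  move=> Ky; apply: continuous_comp; first exact/cf/KO.
  exact: norm_continuous.
have [F F0 HF'] := compact_bounded_for cK cnf.
have HF w : K w -> `|f w| <= F by move=> /HF'; rewrite normr_id.
(* For points more than [r] apart, this crude bound of the contact form on [K], divided by the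
   square of r^gamma, suffices. *)
pose B := (1 + 4 * n%:R * F) * (2 * F).
have B0 : 0 <= B by rewrite !mulr_ge0// addr_ge0// !mulr_ge0.
have rg0 : 0 < (r `^ gamma) ^+ 2 by rewrite exprn_gt0// powR_gt0.
exists (C + C2 + B / (r `^ gamma) ^+ 2).
  by rewrite !addr_ge0// divr_ge0// ltW.
move=> x y Kx Ky.
have p0 := powR_ge0 `|x - y| gamma.
split.
  have inT z : K z -> thicken K1 r z by move=> Kz; apply/thickS/thickS.
  rewrite (le_trans (HC x y (inT x Kx) (inT y Ky)))//.
  by rewrite ler_wpM2r// -addrA lerDl addr_ge0// divr_ge0// ltW.
have [xyr|rxy] := leP `|x - y| r.
  rewrite (le_trans (key y x Ky Kx xyr))// ler_wpM2r ?sqr_ge0//.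
  by rewrite addrAC lerDr addr_ge0// divr_ge0// ltW.
rewrite (@le_trans _ _ (B / (r `^ gamma) ^+ 2 * (`|x - y| `^ gamma) ^+ 2))//;
  last first.
  by rewrite ler_wpM2r ?sqr_ge0// lerDr addr_ge0.
rewrite mulrAC ler_pdivlMr//.
rewrite ler_pM// ?(ltW rg0)//; last by rewrite powR_mono// ltW.
rewrite (le_trans (normr_contact_form _ _))// ler_pM// ?addr_ge0 ?mulr_ge0//.
  by rewrite lerD2l ler_wpM2l// HF.
by rewrite (le_trans (ler_normB _ _))// mulrDl !mul1r lerD// HF.
Qed.
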